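(* Let $f$ and $g$ be two slice regular functions defined on a symmetric domain $\Omega_D$. Then, for any integer $k\ge1$, on $\Omega_D\setminus\mathbb{R}$ we have \begin{align*} (\partial_c\partial_s)^k(f\cdot g)&=\big((\partial_c\partial_s)^k f\big)\cdot v_s g+v_s f\cdot\big((\partial_c\partial_s)^k g\big)\\ &\quad+\frac12\Bigg\{\sum_{h=0}^{k-1}\binom{k-1}{h}\Big[\big(\partial_s(\partial_c\partial_s)^{k-(h+1)}f\big)\cdot\big(\partial_c(\partial_s\partial_c)^h g\big)+\big(\partial_c(\partial_s\partial_c)^h f\big)\cdot\big(\partial_s(\partial_c\partial_s)^{k-(h+1)}g\big)\Big]\\ &\qquad+\sum_{h=1}^{k-1}\binom{k-1}{h}\Big[\big((\partial_c\partial_s)^{k-h}f\big)\cdot\big((\partial_s\partial_c)^h g\big)+\big((\partial_s\partial_c)^h f\big)\cdot\big((\partial_c\partial_s)^{k-h}g\big)\Big]\Bigg\}, \end{align*} where $\cdot$ is the slice product.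
   Context: Quaternions: $\mathbb{H}$ is the algebra of quaternions, $x^c$ the conjugate of $x$, $\operatorname{Im}(x)=(x-x^c)/2$, $\mathbb{S}=\{x\in\mathbb{H}: x^2=-1\}$. Every $x\in\mathbb{H}$ is $x=\alpha+I\beta$ with $\alpha,\beta\in\mathbb{R}$, $\beta\ge0$, $I\in\mathbb{S}$. Symmetric domains and slice functions: let $D\subset\mathbb{C}$ be open with $D=\overline{D}$ (invariant under complex conjugation; it may be disconnected, e.g. $D=\mathbb{C}\setminus\mathbb{R}$). Its circularization $\Omega_D=\{\alpha+I\beta: \alpha+i\beta\in D,\ I\in\mathbb{S}\}$ is called a symmetric domain. A stem function is $F=F_0+\sqrt{-1}F_1:D\to\mathbb{H}\otimes\mathbb{C}$ with $F_0,F_1:D\to\mathbb{H}$, $F_0(\bar z)=F_0(z)$, $F_1(\bar z)=-F_1(z)$. It induces the slice function $f=\mathcal{I}(F):\Omega_D\to\mathbb{H}$, $f(\alpha+I\beta)=F_0(\alpha+i\beta)+I F_1(\alpha+i\beta)$. $f$ is slice regular if $F$ is $C^1$ and holomorphic, i.e. $\partial_\alpha F_0=\partial_\beta F_1$ and $\partial_\beta F_0=-\partial_\alpha F_1$. The slice product of $f=\mathcal{I}(F)$ and $g=\mathcal{I}(G)$ is $f\cdot g=\mathcal{I}(FG)$, where $FG=(F_0G_0-F_1G_1)+\sqrt{-1}(F_0G_1+F_1G_0)$. Operators: for a slice function $f=\mathcal{I}(F)$, the spherical value is the slice function $(v_s f)(x)=\frac{f(x)+f(x^c)}{2}=F_0(\alpha+i\beta)$;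 the spherical derivative is the slice function on $\Omega_D\setminus\mathbb{R}$ given by $(\partial_s f)(x)=(2\operatorname{Im}(x))^{-1}(f(x)-f(x^c))=F_1(\alpha+i\beta)/\beta$; if $F$ is $C^1$, the slice derivative is the slice function $\partial_c f=\mathcal{I}(\partial F/\partial z)$, i.e. $(\partial_c f)(\alpha+I\beta)=\frac12\left(\frac{\partial}{\partial\alpha}-I\frac{\partial}{\partial\beta}\right)(F_0+IF_1)(\alpha+i\beta)$. Powers such as $(\partial_c\partial_s)^k$ denote iterated composition (exponent $0$ is the identity); compositions involving $\partial_s$ are considered on $\Omega_D\setminus\mathbb{R}$. Empty sums are $0$. *)

(* Defs.v *)
From Stdlib Require Import Reals Lra Lia.
From Coquelicot Require Import Coquelicot.

Local Open Scope R_scope.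

Record quat : Type := Quat { q0 : R; q1 : R; q2 : R; q3 : R }.

Declare Scope quat_scope.
Delimit Scope quat_scope with Q.
Bind Scope quat_scope with quat.

Definition RtoQ (r : R) : quat := Quat r 0 0 0.

Definition Qplus (x y : quat) : quat :=
  Quat (q0 x + q0 y) (q1 x + q1 y) (q2 x + q2 y) (q3 x + q3 y).

Definition Qopp (x : quat) : quat := Quat (- q0 x) (- q1 x) (- q2 x) (- q3 x).

Definition Qminus (x y : quat) : quat := Qplus x (Qopp y).

Definition Qmult (x y : quat) : quat :=
  Quat (q0 x * q0 y - q1 x * q1 y - q2 x * q2 y - q3 x * q3 y)
       (q0 x * q1 y + q1 x * q0 y + q2 x * q3 y - q3 x * q2 y)
       (q0 x * q2 y - q1 x * q3 y + q2 x * q0 y + q3 x * q1 y)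
       (q0 x * q3 y + q1 x * q2 y - q2 x * q1 y + q3 x * q0 y).

Definition Qconj (x : quat) : quat := Quat (q0 x) (- q1 x) (- q2 x) (- q3 x).

Definition Qnorm2 (x : quat) : R := q0 x ^ 2 + q1 x ^ 2 + q2 x ^ 2 + q3 x ^ 2.

Notation "x + y" := (Qplus x y) : quat_scope.
Notation "- x" := (Qopp x) : quat_scope.
Notation "x - y" := (Qminus x y) : quat_scope.
Notation "x * y" := (Qmult x y) : quat_scope.

(* Total, with [Qinv 0 = 0]. *)
Definition Qinv (x : quat) : quat := (RtoQ (/ Qnorm2 x) * Qconj x)%Q.

Definition Qre (x : quat) : R := q0 x.
Definition Qim (x : quat) : quat := (RtoQ (1 / 2) * (x - Qconj x))%Q.

Definition in_S (I : quat) : Prop := (I * I)%Q = RtoQ (- 1).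

Lemma quat_eq (x y : quat) :
  q0 x = q0 y -> q1 x = q1 y -> q2 x = q2 y -> q3 x = q3 y -> x = y.
Proof. destruct x, y; simpl; intros; subst; reflexivity. Qed.

Ltac quat_ring :=
  intros; apply quat_eq;
  unfold Qminus, Qim, Qre, RtoQ; simpl; try ring; try (field; fail).

Lemma Qplus_comm (x y : quat) : (x + y)%Q = (y + x)%Q.
Proof. quat_ring. Qed.
Lemma Qplus_assoc (x y z : quat) : (x + (y + z))%Q = (x + y + z)%Q.
Proof. quat_ring. Qed.
Lemma Qplus_0_r (x : quat) : (x + RtoQ 0)%Q = x.
Proof. quat_ring. Qed.
Lemma Qplus_opp_r (x : quat) : (x + - x)%Q = RtoQ 0.
Proof. quat_ring. Qed.
Lemma Qmult_assoc (x y z : quat) : (x * (y * z))%Q = (x * y * z)%Q.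
Proof. quat_ring. Qed.
Lemma Qmult_1_r (x : quat) : (x * RtoQ 1)%Q = x.
Proof. quat_ring. Qed.
Lemma Qmult_1_l (x : quat) : (RtoQ 1 * x)%Q = x.
Proof. quat_ring. Qed.
Lemma Qmult_plus_distr_r (x y z : quat) : ((x + y) * z)%Q = (x * z + y * z)%Q.
Proof. quat_ring. Qed.
Lemma Qmult_plus_distr_l (x y z : quat) : (x * (y + z))%Q = (x * y + x * z)%Q.
Proof. quat_ring. Qed.

Definition quat_AbelianMonoid_mixin :=
  AbelianMonoid.Mixin quat Qplus (RtoQ 0) Qplus_comm Qplus_assoc Qplus_0_r.
Canonical quat_AbelianMonoid :=
  AbelianMonoid.Pack quat quat_AbelianMonoid_mixin quat.

Definition quat_AbelianGroup_mixin :=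
  AbelianGroup.Mixin quat_AbelianMonoid Qopp Qplus_opp_r.
Canonical quat_AbelianGroup :=
  AbelianGroup.Pack quat
    (AbelianGroup.Class quat quat_AbelianMonoid_mixin quat_AbelianGroup_mixin)
    quat.

Definition quat_Ring_mixin :=
  Ring.Mixin quat_AbelianGroup Qmult (RtoQ 1) Qmult_assoc Qmult_1_r Qmult_1_l
    Qmult_plus_distr_r Qmult_plus_distr_l.
Canonical quat_Ring :=
  Ring.Pack quat
    (Ring.Class quat (AbelianGroup.class quat_AbelianGroup) quat_Ring_mixin)
    quat.

(* A function on a subset of [C] or [quat] is a total Coq function of which
   only the values on that subset matter. *)

Definition conj_invariant (D : C -> Prop) : Prop :=
  forall z : C, D z <-> D (Cconj z).

Definition circularization (D : C -> Prop) (x : quat) : Prop :=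
  exists (alpha beta : R) (I : quat),
    D (alpha, beta) /\ in_S I /\ x = (RtoQ alpha + I * RtoQ beta)%Q.

Lemma circularization_intro (D : C -> Prop) (alpha beta : R) (I : quat) :
  D (alpha, beta) -> in_S I ->
  circularization D (RtoQ alpha + I * RtoQ beta)%Q.
Proof. intros; exists alpha, beta, I; auto. Qed.

(* [F z = (F0 z, F1 z)] encodes [F0 z + sqrt(-1) F1 z] in the complexified
   quaternions. *)
Definition stem_fun (D : C -> Prop) (F : C -> quat * quat) : Prop :=
  forall z : C, D z ->
    fst (F (Cconj z)) = fst (F z) /\ snd (F (Cconj z)) = (- snd (F z))%Q.

(* The slice function induced by [F], written with [alpha = Re x],
   [beta = |Im x|] and [I = Im x / |Im x|]; when [x] is real, [Im x] and hence
   the second summand is 0. See [induced_spec]. *)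
Definition induced (F : C -> quat * quat) (x : quat) : quat :=
  let beta := sqrt (Qnorm2 (Qim x)) in
  (fst (F (Qre x, beta)) + RtoQ (/ beta) * Qim x * snd (F (Qre x, beta)))%Q.

Definition Qi : quat := Quat 0 1 0 0.

(* The (unique) stem function of a slice function, recovered from its values on
   the slice spanned by the quaternion unit i. See [stem_of_spec]. *)
Definition stem_of (f : quat -> quat) (z : C) : quat * quat :=
  let x := (RtoQ (Re z) + Qi * RtoQ (Im z))%Q in
  ((RtoQ (1 / 2) * (f x + f (Qconj x)))%Q,
   (- (Qi * (RtoQ (1 / 2) * (f x - f (Qconj x)))))%Q).

Definition d_alpha (u : C -> quat) (z : C) : quat :=
  Quat (Derive (fun a => q0 (u (a, Im z))) (Re z))
       (Derive (fun a => q1 (u (a, Im z))) (Re z))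
       (Derive (fun a => q2 (u (a, Im z))) (Re z))
       (Derive (fun a => q3 (u (a, Im z))) (Re z)).

Definition d_beta (u : C -> quat) (z : C) : quat :=
  Quat (Derive (fun b => q0 (u (Re z, b))) (Im z))
       (Derive (fun b => q1 (u (Re z, b))) (Im z))
       (Derive (fun b => q2 (u (Re z, b))) (Im z))
       (Derive (fun b => q3 (u (Re z, b))) (Im z)).

Definition C1_real (D : C -> Prop) (u : C -> R) : Prop :=
  forall z : C, D z ->
    ex_derive (fun a : R => u (a, Im z)) (Re z) /\
    ex_derive (fun b : R => u (Re z, b)) (Im z) /\
    continuous (fun w : C => Derive (fun a : R => u (a, Im w)) (Re w)) z /\
    continuous (fun w : C => Derive (fun b : R => u (Re w, b)) (Im w)) z.

Definition C1_quat (D : C -> Prop) (u : C -> quat) : Prop :=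
  C1_real D (fun z => q0 (u z)) /\ C1_real D (fun z => q1 (u z)) /\
  C1_real D (fun z => q2 (u z)) /\ C1_real D (fun z => q3 (u z)).

Definition holomorphic_stem (D : C -> Prop) (F : C -> quat * quat) : Prop :=
  let F0 := fun z => fst (F z) in
  let F1 := fun z => snd (F z) in
  C1_quat D F0 /\ C1_quat D F1 /\
  forall z : C, D z ->
    d_alpha F0 z = d_beta F1 z /\ d_beta F0 z = (- d_alpha F1 z)%Q.

Definition slice_regular (D : C -> Prop) (f : quat -> quat) : Prop :=
  exists F : C -> quat * quat,
    stem_fun D F /\ holomorphic_stem D F /\
    forall x : quat, circularization D x -> f x = induced F x.

Definition stem_mult (F G : C -> quat * quat) (z : C) : quat * quat :=
  ((fst (F z) * fst (G z) - snd (F z) * snd (G z))%Q,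
   (fst (F z) * snd (G z) + snd (F z) * fst (G z))%Q).

Definition slice_mult (f g : quat -> quat) : quat -> quat :=
  induced (stem_mult (stem_of f) (stem_of g)).

Definition spherical_value (f : quat -> quat) (x : quat) : quat :=
  (RtoQ (1 / 2) * (f x + f (Qconj x)))%Q.

Definition spherical_derivative (f : quat -> quat) (x : quat) : quat :=
  (Qinv (RtoQ 2 * Qim x) * (f x - f (Qconj x)))%Q.

(* dF/dz = (1/2) (d/dalpha - sqrt(-1) d/dbeta) (F0 + sqrt(-1) F1). *)
Definition stem_dz (F : C -> quat * quat) (z : C) : quat * quat :=
  let F0 := fun w => fst (F w) in
  let F1 := fun w => snd (F w) in
  ((RtoQ (1 / 2) * (d_alpha F0 z + d_beta F1 z))%Q,
   (RtoQ (1 / 2) * (d_alpha F1 z - d_beta F0 z))%Q).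

Definition slice_derivative (f : quat -> quat) : quat -> quat :=
  induced (stem_dz (stem_of f)).

Lemma in_S_coord (I : quat) :
  in_S I -> q0 I = 0 /\ q1 I ^ 2 + q2 I ^ 2 + q3 I ^ 2 = 1.
Proof.
  destruct I as [a b c d]; unfold in_S, Qmult, RtoQ; simpl; intros H.
  injection H as H0 H1 H2 H3.
  assert (Ha : a = 0).
  { destruct (Req_dec a 0) as [E | E]; [exact E | exfalso].
    assert (b = 0) by nra. assert (c = 0) by nra. assert (d = 0) by nra.
    subst; nra. }
  subst; split; [reflexivity | lra].
Qed.

Lemma induced_spec (D : C -> Prop) (F : C -> quat * quat)
    (alpha beta : R) (I : quat) :
  stem_fun D F -> D (alpha, beta) -> in_S I ->
  induced F (RtoQ alpha + I * RtoQ beta)%Q =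
    (fst (F (alpha, beta)) + I * snd (F (alpha, beta)))%Q.
Proof.
  intros HF Hz HI; destruct (in_S_coord I HI) as [Hre Hn].
  assert (Him : Qim (RtoQ alpha + I * RtoQ beta)%Q = (I * RtoQ beta)%Q).
  { quat_ring; rewrite ?Hre; field. }
  assert (Ere : Qre (RtoQ alpha + I * RtoQ beta)%Q = alpha).
  { unfold Qre; simpl; rewrite Hre; ring. }
  assert (En : sqrt (Qnorm2 (I * RtoQ beta)%Q) = Rabs beta).
  { rewrite <- sqrt_Rsqr_abs; f_equal; unfold Qnorm2, Rsqr; simpl; rewrite Hre.
    transitivity ((q1 I ^ 2 + q2 I ^ 2 + q3 I ^ 2) * (beta * beta));
      [ring | rewrite Hn; ring]. }
  unfold induced; rewrite Him, Ere, En; cbv zeta.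
  destruct (HF _ Hz) as [E0 E1]; unfold Cconj in E0, E1; simpl in E0, E1.
  destruct (Rtotal_order beta 0) as [Hb | [Hb | Hb]].
  - rewrite (Rabs_left beta Hb), E0, E1.
    f_equal; quat_ring; field; lra.
  - subst beta; rewrite Ropp_0 in E1; rewrite Rabs_R0.
    assert (Z : snd (F (alpha, 0)) = RtoQ 0).
    { pose proof (f_equal q0 E1) as A0; pose proof (f_equal q1 E1) as A1.
      pose proof (f_equal q2 E1) as A2; pose proof (f_equal q3 E1) as A3.
      simpl in *; apply quat_eq; simpl; lra. }
    rewrite Z; f_equal; quat_ring.
  - rewrite (Rabs_right beta (Rgt_ge _ _ Hb)).
    f_equal; quat_ring; field; lra.
Qed.

Lemma Qi_in_S : in_S Qi.
Proof. unfold in_S; quat_ring. Qed.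

Lemma stem_of_spec (D : C -> Prop) (F : C -> quat * quat) (f : quat -> quat)
    (z : C) :
  conj_invariant D -> stem_fun D F ->
  (forall x : quat, circularization D x -> f x = induced F x) ->
  D z -> stem_of f z = F z.
Proof.
  intros HD HF Hf Hz; destruct z as [a b].
  assert (Hz' : D (a, - b)) by exact (proj1 (HD (a, b)) Hz).
  assert (Ec : Qconj (RtoQ a + Qi * RtoQ b)%Q = (RtoQ a + Qi * RtoQ (- b))%Q)
    by (unfold Qconj; quat_ring).
  destruct (HF _ Hz) as [E0 E1]; unfold Cconj in E0, E1; simpl in E0, E1.
  unfold stem_of; simpl Re; simpl Im; cbv zeta; rewrite Ec.
  rewrite !Hf by (apply circularization_intro; [assumption | exact Qi_in_S]).
  rewrite (induced_spec D F a b Qi HF Hz Qi_in_S).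
  rewrite (induced_spec D F a (- b) Qi HF Hz' Qi_in_S).
  rewrite E0, E1; destruct (F (a, b)) as [u v]; simpl.
  f_equal; quat_ring.
Qed.

Lemma spherical_value_spec (D : C -> Prop) (F : C -> quat * quat)
    (f : quat -> quat) (alpha beta : R) (I : quat) :
  conj_invariant D -> stem_fun D F ->
  (forall x : quat, circularization D x -> f x = induced F x) ->
  D (alpha, beta) -> in_S I ->
  spherical_value f (RtoQ alpha + I * RtoQ beta)%Q = fst (F (alpha, beta)).
Proof.
  intros HD HF Hf Hz HI; destruct (in_S_coord I HI) as [Hre _].
  assert (Hz' : D (alpha, - beta)) by exact (proj1 (HD (alpha, beta)) Hz).
  assert (Ec : Qconj (RtoQ alpha + I * RtoQ beta)%Q
               = (RtoQ alpha + I * RtoQ (- beta))%Q)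
    by (unfold Qconj; quat_ring; rewrite ?Hre; ring).
  destruct (HF _ Hz) as [E0 E1]; unfold Cconj in E0, E1; simpl in E0, E1.
  unfold spherical_value; rewrite Ec.
  rewrite !Hf by (apply circularization_intro; [assumption | exact HI]).
  rewrite (induced_spec D F alpha beta I HF Hz HI).
  rewrite (induced_spec D F alpha (- beta) I HF Hz' HI).
  rewrite E0, E1; quat_ring.
Qed.

Lemma spherical_derivative_spec (D : C -> Prop) (F : C -> quat * quat)
    (f : quat -> quat) (alpha beta : R) (I : quat) :
  conj_invariant D -> stem_fun D F ->
  (forall x : quat, circularization D x -> f x = induced F x) ->
  D (alpha, beta) -> beta <> 0 -> in_S I ->
  spherical_derivative f (RtoQ alpha + I * RtoQ beta)%Q =
    (RtoQ (/ beta) * snd (F (alpha, beta)))%Q.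
Proof.
  intros HD HF Hf Hz Hb HI; destruct (in_S_coord I HI) as [Hre Hn].
  assert (Hz' : D (alpha, - beta)) by exact (proj1 (HD (alpha, beta)) Hz).
  assert (Ec : Qconj (RtoQ alpha + I * RtoQ beta)%Q
               = (RtoQ alpha + I * RtoQ (- beta))%Q)
    by (unfold Qconj; quat_ring; rewrite ?Hre; ring).
  assert (Him : Qim (RtoQ alpha + I * RtoQ beta)%Q = (I * RtoQ beta)%Q)
    by (quat_ring; rewrite ?Hre; field).
  destruct (HF _ Hz) as [E0 E1]; unfold Cconj in E0, E1; simpl in E0, E1.
  assert (Ei : Qinv (RtoQ 2 * (I * RtoQ beta))%Q
               = (RtoQ (/ beta) * (RtoQ (1 / 2) * - I))%Q).
  { unfold Qinv.
    replace (Qnorm2 (RtoQ 2 * (I * RtoQ beta))%Q) with (4 * beta ^ 2).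
    - quat_ring; rewrite ?Hre; field; exact Hb.
    - unfold Qnorm2; simpl; rewrite Hre.
      transitivity (4 * beta ^ 2 * (q1 I ^ 2 + q2 I ^ 2 + q3 I ^ 2));
        [rewrite Hn; ring | ring]. }
  unfold spherical_derivative; rewrite Ec, Him, Ei.
  rewrite !Hf by (apply circularization_intro; [assumption | exact HI]).
  rewrite (induced_spec D F alpha beta I HF Hz HI).
  rewrite (induced_spec D F alpha (- beta) I HF Hz' HI).
  rewrite E0, E1.
  set (v := snd (F (alpha, beta))); set (u := fst (F (alpha, beta))).
  transitivity (RtoQ (/ beta) * (- (I * I)) * v)%Q.
  - quat_ring; field; exact Hb.
  - unfold in_S in HI; rewrite HI; quat_ring.
Qed.

Lemma locally_slices (D : C -> Prop) (z : C) :
  open D -> D z ->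
  locally (Re z) (fun a : R => D (a, Im z)) /\
  locally (Im z) (fun b : R => D (Re z, b)).
Proof.
  intros HD Hz; destruct (HD z Hz) as [e He].
  split; exists e; intros t Ht; apply He; split; simpl;
    first [exact Ht | apply ball_center].
Qed.

Lemma stem_dz_spec (D : C -> Prop) (F : C -> quat * quat)
    (f : quat -> quat) (z : C) :
  open D -> conj_invariant D -> stem_fun D F ->
  (forall x : quat, circularization D x -> f x = induced F x) ->
  D z -> stem_dz (stem_of f) z = stem_dz F z.
Proof.
  intros HO HD HF Hf Hz; destruct (locally_slices D z HO Hz) as [La Lb].
  assert (E : forall w, D w -> stem_of f w = F w)
    by (intros w Hw; exact (stem_of_spec D F f w HD HF Hf Hw)).
  assert (A : forall p : quat * quat -> quat,
    d_alpha (fun w => p (stem_of f w)) z = d_alpha (fun w => p (F w)) z).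
  { intros p; unfold d_alpha; f_equal; apply Derive_ext_loc;
      apply filter_imp with (2 := La); intros t Ht; rewrite (E _ Ht); reflexivity. }
  assert (B : forall p : quat * quat -> quat,
    d_beta (fun w => p (stem_of f w)) z = d_beta (fun w => p (F w)) z).
  { intros p; unfold d_beta; f_equal; apply Derive_ext_loc;
      apply filter_imp with (2 := Lb); intros t Ht; rewrite (E _ Ht); reflexivity. }
  unfold stem_dz; cbv zeta.
  rewrite (A fst), (A snd), (B fst), (B snd); reflexivity.
Qed.

Notation "'v_s'" := spherical_value : quat_scope.
Notation "'∂s'" := spherical_derivative : quat_scope.
Notation "'∂c'" := slice_derivative : quat_scope.
Notation "f ⋅ g" := (slice_mult f g) (at level 40, left associativity)
  : quat_scope.

Definition cs_pow (n : nat) (f : quat -> quat) : quat -> quat :=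
  Nat.iter n (fun u => slice_derivative (spherical_derivative u)) f.

Definition sc_pow (n : nat) (f : quat -> quat) : quat -> quat :=
  Nat.iter n (fun u => spherical_derivative (slice_derivative u)) f.

(* Main.v *)
Require Import Defs.
From Stdlib Require Import Reals Lra Lia.
From Coquelicot Require Import Coquelicot.

(* On a slice function with stem [(u, 0)], [∂s ∂c] is the operator
   [L = - (1 / (2 beta)) d/dbeta], a derivation for the pointwise product, and
   [∂c] is [u |-> (d_alpha u, - d_beta u) / 2]. If [f = I(F)] is regular, put
   [a = 2 F0] and [p = F1 / beta]: then [∂s (∂c ∂s)^n f] has stem [L^n p],
   [∂c (∂s ∂c)^n f] is [∂c] of [L^n a] (because [F] is holomorphic), and hence
   [(∂s ∂c)^n f] has stem [L^n a] for [n >= 1], while [v_s f] has stem [a / 2].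
   With [b] and [q] the analogous functions for [g], the function [∂s (f ⋅ g)]
   has stem [(a q + p b) / 2], so the formula is the Leibniz rule for [L^(k-1)]
   followed by the one for [∂c].

   All iterated derivatives must exist, so one needs that a [C^1] holomorphic
   function has a [C^1] holomorphic derivative. This comes from the Cauchy
   formula on a circle, obtained by contracting the circle [zeta] to [w] in
   [int F (w + s (zeta - w)) / (zeta - w) dzeta]: the [s]-derivative of the
   integrand is, up to a constant factor, a derivative along the circle. *)

Local Open Scope C_scope.

(** * Cauchy integrals *)

(** Noncommutativity and the shape of the formula are both governed by one doubly indexed family,
    [e i j = (L^i a L^j q + L^j p L^i b) / 2]. The same index counts the derivatives of [a] and of
    [b], so the recursion [L (e i j) = e (S i) j + e i (S j)] respects the order of the factors, and
    the two products in [∂s (f ⋅ g)] share one binomial sum. When [∂c] is applied, the derivatives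
    falling on [a] or [b] produce the first sum of the statement, those falling on [p] or [q] the
    second. In the latter the term [h = 0] contains [2 F0] and [2 G0] instead of the full stems of
    [f] and [g]: this is why it stands apart, with spherical values, and why it carries no factor
    1/2. On the analytic side, the derivative is continuous by the [C^1] hypothesis, so one may
    differentiate under the integral sign and needs no argument of Goursat type. Smoothness being
    local, circles around single points suffice, whatever the shape of the domain. *)

Lemma Cmod_le_abs (z : C) : (Cmod z <= Rabs (Re z) + Rabs (Im z))%R.
Proof.
  destruct z as [x y]; simpl.
  replace (x, y) with (RtoC x + RtoC y * Ci)
    by (unfold RtoC, Ci, Cplus, Cmult; simpl; f_equal; ring).
  eapply Rle_trans; [apply Cmod_triangle|].
  rewrite Cmod_mult, Cmod_Ci, !Cmod_R; lra.
Qed.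

Lemma im_le_Cmod (z : C) : (Rabs (Im z) <= Cmod z)%R.
Proof.
  eapply Rle_trans; [|apply Rmax_Cmod]; apply Rmax_r.
Qed.

Lemma Cmod_triangle_minus (z w : C) : (Cmod z - Cmod w <= Cmod (z - w))%R.
Proof.
  pose proof (Cmod_triangle (z - w) w) as H.
  replace (z - w + w) with z in H by ring; lra.
Qed.

Lemma locally_Cmod_lt (z : C) (r : posreal) (P : C -> Prop) :
  (forall w : C, (Cmod (w - z) < r)%R -> P w) -> locally z P.
Proof.
  (* Balls of [C] are squares, the uniform structure being that of a product; radius [r / 2] puts
     the square inside the disc. *)
  intros H; assert (Hr : (0 < r / 2)%R) by (destruct r; simpl; lra).
  exists (mkposreal _ Hr); intros w [H1 H2]; apply H.
  eapply Rle_lt_trans; [apply Cmod_le_abs|].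
  unfold ball in H1, H2; simpl in H1, H2.
  unfold AbsRing_ball, abs, minus, plus, opp in H1, H2; simpl in H1, H2.
  destruct w, z; simpl in *; unfold Rminus in *; lra.
Qed.

Lemma locally_Cmod_ex (z : C) (P : C -> Prop) :
  locally z P ->
  exists r : posreal, forall w : C, (Cmod (w - z) < r)%R -> P w.
Proof.
  intros [r H]; exists r; intros w Hw; apply H.
  apply C_NormedModule_mixin_compat1; exact Hw.
Qed.

Lemma continuous_C {U : UniformSpace} (f : U -> C) (x : U) :
  continuous (fun y => Re (f y)) x -> continuous (fun y => Im (f y)) x ->
  continuous f x.
Proof.
  intros H1 H2; apply filterlim_locally; intros eps.
  generalize (proj1 (filterlim_locally _ _) H1 eps)
             (proj1 (filterlim_locally _ _) H2 eps).
  intros A B; generalize (filter_and _ _ A B); apply filter_imp.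
  intros y [A' B']; split; assumption.
Qed.

Lemma continuous_Re {U : UniformSpace} (f : U -> C) (x : U) :
  continuous f x -> continuous (fun y => Re (f y)) x.
Proof.
  intros H; apply (continuous_comp f Re); [exact H|].
  destruct (f x); apply continuous_fst.
Qed.

Lemma continuous_Im {U : UniformSpace} (f : U -> C) (x : U) :
  continuous f x -> continuous (fun y => Im (f y)) x.
Proof.
  intros H; apply (continuous_comp f Im); [exact H|].
  destruct (f x); apply continuous_snd.
Qed.

Lemma continuous_Cplus {U : UniformSpace} (f g : U -> C) (x : U) :
  continuous f x -> continuous g x -> continuous (fun y => f y + g y) x.
Proof.
  intros Hf Hg; apply continuous_C.
  - apply (continuous_plus (V := R_NormedModule) (fun y => Re (f y)) (fun y => Re (g y)));
      apply continuous_Re; assumption.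
  - apply (continuous_plus (V := R_NormedModule) (fun y => Im (f y)) (fun y => Im (g y)));
      apply continuous_Im; assumption.
Qed.

Lemma continuous_Copp {U : UniformSpace} (f : U -> C) (x : U) :
  continuous f x -> continuous (fun y => - f y) x.
Proof.
  intros Hf; apply continuous_C.
  - apply (continuous_opp (V := R_NormedModule) (fun y => Re (f y)));
      apply continuous_Re; assumption.
  - apply (continuous_opp (V := R_NormedModule) (fun y => Im (f y)));
      apply continuous_Im; assumption.
Qed.

Lemma continuous_Cminus {U : UniformSpace} (f g : U -> C) (x : U) :
  continuous f x -> continuous g x -> continuous (fun y => f y - g y) x.
Proof.
  intros; apply (continuous_Cplus f (fun y => - g y));
    [|apply continuous_Copp]; assumption.
Qed.

Lemma continuous_Rmult {U : UniformSpace} (f g : U -> R) (x : U) :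
  continuous f x -> continuous g x -> continuous (fun y => f y * g y)%R x.
Proof. apply (continuous_mult (K := R_AbsRing)). Qed.

Lemma continuous_Cmult {U : UniformSpace} (f g : U -> C) (x : U) :
  continuous f x -> continuous g x -> continuous (fun y => f y * g y) x.
Proof.
  intros Hf Hg.
  pose proof (continuous_Re _ _ Hf); pose proof (continuous_Im _ _ Hf).
  pose proof (continuous_Re _ _ Hg); pose proof (continuous_Im _ _ Hg).
  apply continuous_C.
  - apply (continuous_minus (V := R_NormedModule)
      (fun y => Re (f y) * Re (g y))%R (fun y => Im (f y) * Im (g y))%R);
      apply continuous_Rmult; assumption.
  - apply (continuous_plus (V := R_NormedModule)
      (fun y => Re (f y) * Im (g y))%R (fun y => Im (f y) * Re (g y))%R);
      apply continuous_Rmult; assumption.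
Qed.

Lemma continuous_Cinv {U : UniformSpace} (f : U -> C) (x : U) :
  continuous f x -> f x <> 0 -> continuous (fun y => / f y) x.
Proof.
  intros Hf Hx.
  pose proof (continuous_Re _ _ Hf) as A; pose proof (continuous_Im _ _ Hf) as B.
  assert (N : continuous (fun y => / (Re (f y) ^ 2 + Im (f y) ^ 2))%R x).
  { apply (continuous_comp (fun y => (Re (f y) ^ 2 + Im (f y) ^ 2)%R) Rinv).
    - apply (continuous_plus (V := R_NormedModule)
        (fun y => Re (f y) ^ 2)%R (fun y => Im (f y) ^ 2)%R); simpl;
      repeat (apply continuous_Rmult; try assumption); apply continuous_const.
    - apply (continuous_Rinv_comp (fun t => t)); [apply continuous_id|].
      intros E; apply Hx; rewrite <- Cmod2_alt in E.
      apply Cmod_eq_0. destruct (Req_dec (Cmod (f x)) 0); [assumption|].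
      apply pow_nonzero with (n := 2%nat) in H; contradiction. }
  apply continuous_C.
  - apply (continuous_Rmult (fun y => Re (f y))); assumption.
  - apply (continuous_Rmult (fun y => - Im (f y))%R); [|assumption].
    apply (continuous_opp (V := R_NormedModule) (fun y => Im (f y))); assumption.
Qed.

Lemma continuous_Cpow {U : UniformSpace} (f : U -> C) (n : nat) (x : U) :
  continuous f x -> continuous (fun y => f y ^ n) x.
Proof.
  intros Hf; induction n as [|n IH]; [apply continuous_const|].
  apply (continuous_Cmult f (fun y => f y ^ n)); assumption.
Qed.

Lemma Cmod_continuous {U : UniformSpace} (f : U -> C) (x : U) :
  continuous f x -> continuous (fun y => Cmod (f y)) x.
Proof.
  intros Hf.
  pose proof (continuous_Re _ _ Hf) as A; pose proof (continuous_Im _ _ Hf) as B.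
  apply (continuous_comp (fun y => (Re (f y) ^ 2 + Im (f y) ^ 2)%R) sqrt).
  - apply (continuous_plus (V := R_NormedModule)
        (fun y => Re (f y) ^ 2)%R (fun y => Im (f y) ^ 2)%R); simpl;
      repeat (apply continuous_Rmult; try assumption); apply continuous_const.
  - apply continuous_sqrt.
Qed.

(** Componentwise, so that the real theorems on primitives and on integrals with a parameter
    apply. *)
Definition CInt (f : R -> C) (a b : R) : C :=
  (RInt (fun t => Re (f t)) a b, RInt (fun t => Im (f t)) a b).

Lemma ex_RInt_Re (f : R -> C) (a b : R) :
  (forall t, continuous f t) -> ex_RInt (fun t => Re (f t)) a b.
Proof.
  intros H; apply (ex_RInt_continuous (V := R_CompleteNormedModule)); intros t _.
  apply continuous_Re, H.
Qed.

Lemma ex_RInt_Im (f : R -> C) (a b : R) :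
  (forall t, continuous f t) -> ex_RInt (fun t => Im (f t)) a b.
Proof.
  intros H; apply (ex_RInt_continuous (V := R_CompleteNormedModule)); intros t _.
  apply continuous_Im, H.
Qed.

Lemma CInt_ext (f g : R -> C) (a b : R) :
  (forall t, f t = g t) -> CInt f a b = CInt g a b.
Proof.
  intros H; unfold CInt; f_equal; apply RInt_ext; intros t _; rewrite H; reflexivity.
Qed.

Lemma CInt_minus (f g : R -> C) (a b : R) :
  (forall t, continuous f t) -> (forall t, continuous g t) ->
  CInt (fun t => f t - g t) a b = CInt f a b - CInt g a b.
Proof.
  intros Hf Hg; unfold CInt, Cminus, Cplus, Copp; simpl; f_equal.
  - apply (RInt_minus (V := R_CompleteNormedModule)
      (fun t => Re (f t)) (fun t => Re (g t))); apply ex_RInt_Re; assumption.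
  - apply (RInt_minus (V := R_CompleteNormedModule)
      (fun t => Im (f t)) (fun t => Im (g t))); apply ex_RInt_Im; assumption.
Qed.

Lemma CInt_scal (c : C) (f : R -> C) (a b : R) :
  (forall t, continuous f t) ->
  CInt (fun t => c * f t) a b = c * CInt f a b.
Proof.
  intros Hf; unfold CInt, Cmult; simpl.
  pose proof (ex_RInt_Re f a b Hf) as A; pose proof (ex_RInt_Im f a b Hf) as B.
  f_equal; apply (is_RInt_unique (V := R_CompleteNormedModule)).
  - apply (is_RInt_minus (V := R_NormedModule)
      (fun t => fst c * Re (f t))%R (fun t => snd c * Im (f t))%R);
    apply (is_RInt_scal (V := R_NormedModule));
    apply (RInt_correct (V := R_CompleteNormedModule)); assumption.
  - apply (is_RInt_plus (V := R_NormedModule)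
      (fun t => fst c * Im (f t))%R (fun t => snd c * Re (f t))%R);
    apply (is_RInt_scal (V := R_NormedModule));
    apply (RInt_correct (V := R_CompleteNormedModule)); assumption.
Qed.

(** Real and imaginary parts are bounded separately, hence the factor 2; later only the finiteness
    of the constant matters. *)
Lemma Cmod_CInt_le (f : R -> C) (a b M : R) :
  (a <= b)%R -> (forall t, continuous f t) ->
  (forall t, (a <= t <= b)%R -> (Cmod (f t) <= M)%R) ->
  (Cmod (CInt f a b) <= 2 * ((b - a) * M))%R.
Proof.
  intros Hab Hf HM; eapply Rle_trans; [apply Cmod_le_abs|]; simpl.
  assert (A : (Rabs (RInt (fun t => Re (f t)) a b) <= (b - a) * M)%R).
  { apply abs_RInt_le_const; [assumption | apply ex_RInt_Re; assumption |].
    intros t Ht; eapply Rle_trans; [apply re_le_Cmod | apply HM, Ht]. }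
  assert (B : (Rabs (RInt (fun t => Im (f t)) a b) <= (b - a) * M)%R).
  { apply abs_RInt_le_const; [assumption | apply ex_RInt_Im; assumption |].
    intros t Ht; eapply Rle_trans; [apply im_le_Cmod | apply HM, Ht]. }
  lra.
Qed.

(** Induction on [n] from [y - z = h y z], where [y = 1 / (x - h)] and [z = 1 / x]. The constant
    depends on [M] and [n] alone, so the estimate is uniform in [x] and can be integrated along a
    curve. *)
Lemma pow_inv_taylor_bound (M : R) (n : nat) :
  (0 <= M)%R ->
  exists K : R, (0 <= K)%R /\ forall x h : C, x <> 0 -> x - h <> 0 ->
    (Cmod (/ x) <= M)%R -> (Cmod (/ (x - h)) <= M)%R ->
    (Cmod ((/ (x - h)) ^ n - (/ x) ^ n - h * (RtoC (INR n) * (/ x) ^ S n))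
     <= K * Cmod h ^ 2)%R.
Proof.
  intros HM; induction n as [|n [K [HK IH]]].
  - exists 0%R; split; [lra|]; intros x h _ _ _ _; simpl.
    replace (1 - 1 - h * (0 * (/ x * 1))) with (RtoC 0) by ring.
    rewrite Cmod_0; lra.
  - exists (M * K + (INR n * M ^ S n * M * M + M ^ n * M * M * M))%R; split.
    { assert (0 <= INR n)%R by apply pos_INR.
      assert (0 <= M ^ n)%R by (apply pow_le; assumption).
      assert (0 <= M ^ S n)%R by (apply pow_le; assumption).
      assert (0 <= M * K)%R by (apply Rmult_le_pos; assumption).
      assert (0 <= INR n * M ^ S n * M * M)%R
        by (repeat apply Rmult_le_pos; assumption).
      assert (0 <= M ^ n * M * M * M)%R
        by (repeat apply Rmult_le_pos; assumption).
      lra. }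
    intros x h Hx Hxh HMx HMy; specialize (IH x h Hx Hxh HMx HMy).
    set (y := / (x - h)) in *; set (z := / x) in *.
    assert (Ez : y - z = h * y * z) by (unfold y, z; field; auto).
    replace (y ^ S n - z ^ S n - h * (RtoC (INR (S n)) * z ^ S (S n)))
      with (y * (y ^ n - z ^ n - h * (RtoC (INR n) * z ^ S n))
            + (RtoC (INR n) * z ^ S n * y * z + z ^ n * y * z * z) * h ^ 2).
    2: { rewrite S_INR, RtoC_plus, !Cpow_S.
         assert (Y : y = z + h * y * z) by (rewrite <- Ez; ring).
         (* [ring] cannot use [Ez], so the difference of the two sides is displayed as a multiple of
            [h * y * z - (y - z)]. *)
         transitivity (y * y ^ n - z * z ^ n
           - h * ((RtoC (INR n) + 1) * (z * (z * z ^ n)))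
           + (h * y * z - (y - z)) * (z ^ n + h * (RtoC (INR n) + 1) * z * z ^ n)).
         - ring.
         - rewrite <- Ez; ring. }
    eapply Rle_trans; [apply Cmod_triangle|].
    rewrite !Cmod_mult.
    assert (P0 : (0 <= Cmod h ^ 2)%R) by (apply pow_le, Cmod_ge_0).
    rewrite Rmult_plus_distr_r; apply Rplus_le_compat.
    + rewrite Rmult_assoc; apply Rmult_le_compat;
        first [apply Cmod_ge_0 | assumption].
    + rewrite Cmod_pow; apply Rmult_le_compat_r; [assumption|].
      eapply Rle_trans; [apply Cmod_triangle|].
      rewrite !Cmod_mult, !Cmod_pow, Cmod_R, (Rabs_pos_eq (INR n)) by apply pos_INR.
      assert (0 <= INR n)%R by apply pos_INR.
      pose proof (Cmod_ge_0 y); pose proof (Cmod_ge_0 z).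
      assert (forall m, (0 <= Cmod z ^ m <= M ^ m)%R)
        by (intros m; split; [apply pow_le | apply pow_incr]; auto).
      apply Rplus_le_compat;
      repeat (apply Rmult_le_compat; repeat apply Rmult_le_pos; 
              try apply H2; try assumption; try apply Rle_refl).
Qed.

(** The Jacobian is that of multiplication by [l]: complex differentiability in a form to which the
    chain rule for two real variables applies. *)
Definition is_cderiv (F : C -> C) (z l : C) : Prop :=
  differentiable_pt_lim (fun x y => Re (F (x, y))) (Re z) (Im z) (Re l) (- Im l) /\
  differentiable_pt_lim (fun x y => Im (F (x, y))) (Re z) (Im z) (Im l) (Re l).

Definition cderiv (F : C -> C) (z : C) : C :=
  (Derive (fun a => Re (F (a, Im z))) (Re z),
   Derive (fun a => Im (F (a, Im z))) (Re z)).

(** Continuity of the derivative is part of the notion: the [C^1] hypothesis on stems supplies it,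
    and the Cauchy formula uses it to differentiate under the integral. *)
Definition holomorphic (D : C -> Prop) (F : C -> C) : Prop :=
  forall z : C, D z -> is_cderiv F z (cderiv F z) /\ continuous (cderiv F) z.

Lemma is_cderiv_unique (F : C -> C) (z l : C) :
  is_cderiv F z l -> cderiv F z = l.
Proof.
  intros [H1 H2]; unfold cderiv.
  apply differentiable_pt_lim_unique in H1; apply differentiable_pt_lim_unique in H2.
  rewrite (proj1 H1), (proj1 H2); destruct l; reflexivity.
Qed.

Lemma is_cderiv_ext_loc (F G : C -> C) (z l : C) :
  locally z (fun w => F w = G w) -> is_cderiv F z l -> is_cderiv G z l.
Proof.
  intros HE [H1 H2].
  assert (L : locally_2d (fun x y => F (x, y) = G (x, y)) (Re z) (Im z)).
  { apply (locally_2d_locally (fun x y => F (x, y) = G (x, y))).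
    destruct z; apply filter_imp with (2 := HE); intros [x y]; exact (fun e => e). }
  destruct L as [d L].
  split; [apply differentiable_pt_lim_ext with (2 := H1)
         | apply differentiable_pt_lim_ext with (2 := H2)];
    exists d; intros u v Hu Hv; rewrite (L u v Hu Hv); reflexivity.
Qed.

(** A quadratic remainder with a fixed constant is the form of differentiability that passes through
    an integral. *)
Lemma is_cderiv_quadratic (F : C -> C) (z l : C) (r : posreal) (K : R) :
  (forall h : C, (Cmod h < r)%R ->
     (Cmod (F (z + h)%C - F z - h * l) <= K * Cmod h ^ 2)%R) ->
  is_cderiv F z l.
Proof.
  intros H.
  assert (HK : forall eps : posreal, locally_2d (fun x y =>
     (Cmod (F (x, y) - F z - ((x, y) - z) * l) <=
       eps * Rmax (Rabs (x - Re z)) (Rabs (y - Im z)))%R) (Re z) (Im z)).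
  { intros eps.
    (* With [m] the sup distance one has [Cmod h <= 2 * m]. The bound [r / 2] therefore keeps [h] in
       the disc where [H] holds, and the second bound makes [4 * (Rabs K + 1) * m ^ 2] at most
       [eps * m]. [Rabs K + 1] is positive whatever the sign of [K]. *)
    assert (Hd : (0 < Rmin (r / 2) (eps / (2 * (Rabs K + 1) * 2)))%R).
    { apply Rmin_pos; [destruct r; simpl; lra|].
      apply Rdiv_lt_0_compat; [apply cond_pos|].
      pose proof (Rabs_pos K); lra. }
    exists (mkposreal _ Hd); simpl; intros x y Hx Hy.
    set (h := (x, y) - z).
    assert (Eh : z + h = (x, y)) by (unfold h; ring).
    set (m := Rmax (Rabs (x - Re z)) (Rabs (y - Im z))).
    assert (Hm : (Cmod h <= 2 * m)%R).
    { eapply Rle_trans; [apply Cmod_le_abs|].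
      unfold h, m, Cminus, Cplus, Copp; simpl.
      pose proof (Rmax_l (Rabs (x - Re z)) (Rabs (y - Im z))).
      pose proof (Rmax_r (Rabs (x - Re z)) (Rabs (y - Im z))).
      unfold Re, Im, Rminus in *; lra. }
    assert (Hmd : (m < Rmin (r / 2) (eps / (2 * (Rabs K + 1) * 2)))%R)
      by (apply Rmax_lub_lt; assumption).
    pose proof (Rmin_l (r / 2) (eps / (2 * (Rabs K + 1) * 2))).
    pose proof (Rmin_r (r / 2) (eps / (2 * (Rabs K + 1) * 2))).
    assert (Hr : (Cmod h < r)%R) by lra.
    specialize (H h Hr); rewrite Eh in H.
    eapply Rle_trans; [exact H|].
    assert (M0 : (0 <= m)%R).
    { eapply Rle_trans; [apply Rabs_pos | apply Rmax_l]. }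
    pose proof (Rabs_pos K) as K0. pose proof (Rle_abs K) as K1.
    pose proof (Cmod_ge_0 h) as C0.
    assert (H4 : (Cmod h ^ 2 <= 4 * (m * m))%R).
    { simpl; rewrite Rmult_1_r.
      replace (4 * (m * m))%R with ((2 * m) * (2 * m))%R by ring.
      apply Rmult_le_compat; assumption. }
    apply Rle_trans with ((Rabs K + 1) * (4 * (m * m)))%R.
    { apply Rle_trans with ((Rabs K + 1) * Cmod h ^ 2)%R.
      - apply Rmult_le_compat_r; [apply pow_le; assumption | lra].
      - apply Rmult_le_compat_l; [lra | assumption]. }
    replace ((Rabs K + 1) * (4 * (m * m)))%R
      with ((2 * (Rabs K + 1) * 2) * m * m)%R by ring.
    apply Rmult_le_compat_r; [assumption|].
    apply Rle_trans with ((2 * (Rabs K + 1) * 2) * (eps / (2 * (Rabs K + 1) * 2)))%R.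
    - apply Rmult_le_compat_l; lra.
    - right; field; lra. }
  split; intros eps; destruct (HK eps) as [d Hd]; exists d; intros x y Hx Hy;
    (eapply Rle_trans; [|exact (Hd x y Hx Hy)]).
  - replace (Re (F (x, y)) - Re (F (Re z, Im z)) - (Re l * (x - Re z) + - Im l * (y - Im z)))%R
      with (Re (F (x, y) - F z - ((x, y) - z) * l)); [apply re_le_Cmod|].
    destruct z as [p q]; simpl; destruct l, (F (x, y)), (F (p, q)); simpl; ring.
  - replace (Im (F (x, y)) - Im (F (Re z, Im z)) - (Im l * (x - Re z) + Re l * (y - Im z)))%R
      with (Im (F (x, y) - F z - ((x, y) - z) * l)); [apply im_le_Cmod|].
    destruct z as [p q]; simpl; destruct l, (F (x, y)), (F (p, q)); simpl; ring.
Qed.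

Lemma is_cderiv_continuous (F : C -> C) (z l : C) :
  is_cderiv F z l -> continuous F z.
Proof.
  intros [H1 H2].
  assert (A : continuity_2d_pt (fun x y => Re (F (x, y))) (Re z) (Im z))
    by (apply differentiable_continuity_pt; eexists; eexists; exact H1).
  assert (B : continuity_2d_pt (fun x y => Im (F (x, y))) (Re z) (Im z))
    by (apply differentiable_continuity_pt; eexists; eexists; exact H2).
  apply continuity_2d_pt_filterlim in A; apply continuity_2d_pt_filterlim in B.
  destruct z as [x y]; simpl in A, B.
  apply continuous_C.
  - refine (filterlim_ext _ _ _ A); intros [u v]; reflexivity.
  - refine (filterlim_ext _ _ _ B); intros [u v]; reflexivity.
Qed.

Lemma is_cderiv_curve (F : C -> C) (g1 g2 : R -> R) (t d1 d2 : R) (l : C) :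
  is_cderiv F (g1 t, g2 t) l -> is_derive g1 t d1 -> is_derive g2 t d2 ->
  is_derive (fun s => Re (F (g1 s, g2 s))) t (Re (l * (d1, d2))) /\
  is_derive (fun s => Im (F (g1 s, g2 s))) t (Im (l * (d1, d2))).
Proof.
  intros [H1 H2] D1 D2; apply is_derive_Reals in D1; apply is_derive_Reals in D2.
  split; apply is_derive_Reals.
  - replace (Re (l * (d1, d2))) with (Re l * d1 + - Im l * d2)%R
      by (simpl; unfold Re, Im; ring).
    apply (derivable_pt_lim_comp_2d (fun x y => Re (F (x, y)))); assumption.
  - replace (Im (l * (d1, d2))) with (Im l * d1 + Re l * d2)%R
      by (simpl; unfold Re, Im; ring).
    apply (derivable_pt_lim_comp_2d (fun x y => Im (F (x, y)))); assumption.
Qed.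

Lemma is_cderiv_partials (F : C -> C) (z l : C) :
  is_cderiv F z l ->
  is_derive (fun a => Re (F (a, Im z))) (Re z) (Re l) /\
  is_derive (fun a => Im (F (a, Im z))) (Re z) (Im l) /\
  is_derive (fun b => Re (F (Re z, b))) (Im z) (- Im l)%R /\
  is_derive (fun b => Im (F (Re z, b))) (Im z) (Re l).
Proof.
  intros H; destruct z as [x y]; simpl in *.
  destruct (is_cderiv_curve F (fun a => a) (fun _ => y) x 1 0 l H) as [A B];
    [exact (is_derive_id (K := R_AbsRing) _) | exact (is_derive_const (K := R_AbsRing) (V := R_NormedModule) _ _) |].
  destruct (is_cderiv_curve F (fun _ => x) (fun b => b) y 0 1 l H) as [E G];
    [exact (is_derive_const (K := R_AbsRing) (V := R_NormedModule) _ _) | exact (is_derive_id (K := R_AbsRing) _) |].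
  simpl in *.
  rewrite Rmult_1_r, Rmult_0_r, Rminus_0_r in A.
  rewrite Rmult_1_r, Rmult_0_r, Rplus_0_l in B.
  rewrite Rmult_1_r, Rmult_0_r, Rminus_0_l in E.
  rewrite Rmult_1_r, Rmult_0_r, Rplus_0_r in G.
  tauto.
Qed.

(** Continuity of the [alpha]-partials gives real differentiability through [is_derive_filterdiff];
    the Cauchy-Riemann equations then make the differential complex linear. *)
Lemma is_cderiv_CR (u v ua ub va vb : C -> R) (D : C -> Prop) (z : C) :
  open D -> D z ->
  (forall w, D w -> is_derive (fun a => u (a, Im w)) (Re w) (ua w)) ->
  (forall w, D w -> is_derive (fun b => u (Re w, b)) (Im w) (ub w)) ->
  (forall w, D w -> is_derive (fun a => v (a, Im w)) (Re w) (va w)) ->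
  (forall w, D w -> is_derive (fun b => v (Re w, b)) (Im w) (vb w)) ->
  continuous ua z -> continuous va z ->
  ua z = vb z -> ub z = (- va z)%R ->
  is_cderiv (fun w => (u w, v w)) z (ua z, va z).
Proof.
  intros HO Hz Hua Hub Hva Hvb Ca Cv E1 E2; destruct z as [x y].
  assert (L : locally (x, y) D) by (apply HO; exact Hz).
  split; simpl; apply filterdiff_differentiable_pt_lim.
  - apply (filterdiff_ext_lin _ (fun h : R * R =>
      plus (scal (fst h) (ua (x, y))) (scal (snd h) (ub (x, y)))));
      [|intros h; simpl; rewrite E2; reflexivity].
    apply (is_derive_filterdiff (fun a b => u (a, b)) x y (fun a b => ua (a, b)) (ub (x, y))).
    + apply filter_imp with (2 := L); intros [a b] Hw; exact (Hua (a, b) Hw).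
    + exact (Hub (x, y) Hz).
    + refine (continuous_ext _ _ _ _ Ca); intros [a b]; reflexivity.
  - apply (filterdiff_ext_lin _ (fun h : R * R =>
      plus (scal (fst h) (va (x, y))) (scal (snd h) (vb (x, y)))));
      [|intros h; simpl; rewrite <- E1; reflexivity].
    apply (is_derive_filterdiff (fun a b => v (a, b)) x y (fun a b => va (a, b)) (vb (x, y))).
    + apply filter_imp with (2 := L); intros [a b] Hw; exact (Hva (a, b) Hw).
    + exact (Hvb (x, y) Hz).
    + refine (continuous_ext _ _ _ _ Cv); intros [a b]; reflexivity.
Qed.

(** The factor [d zeta / dt] is left to [phi]. The exponent is free because differentiation in [w]
    raises it by one. *)
Definition cauchy_int (phi zeta : R -> C) (a b : R) (n : nat) (w : C) : C :=
  CInt (fun t => phi t * (/ (zeta t - w)) ^ n) a b.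

Lemma continuous_cauchy_integrand (phi zeta : R -> C) (n : nat) (w : C) (t : R) :
  (forall t, continuous phi t) -> (forall t, continuous zeta t) ->
  (forall t, zeta t - w <> 0) ->
  continuous (fun t => phi t * (/ (zeta t - w)) ^ n) t.
Proof.
  intros Hp Hz Hw.
  apply (continuous_Cmult phi (fun t => (/ (zeta t - w)) ^ n)); [apply Hp|].
  apply (continuous_Cpow (fun t => / (zeta t - w))).
  apply (continuous_Cinv (fun t => zeta t - w)); [|apply Hw].
  apply (continuous_Cminus zeta (fun _ => w)); [apply Hz | apply continuous_const].
Qed.

Lemma continuous_bounded (phi : R -> C) (a b : R) :
  (a <= b)%R ->
  (forall t, continuous phi t) ->
  exists B : R, (0 <= B)%R /\ forall t, (a <= t <= b)%R -> (Cmod (phi t) <= B)%R.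
Proof.
  intros Hab Hp.
  destruct (continuity_ab_maj (fun t => Cmod (phi t)) a b Hab) as [M [HM _]].
  - intros t _; apply continuity_pt_filterlim.
    exact (Cmod_continuous phi t (Hp t)).
  - exists (Cmod (phi M)); split; [apply Cmod_ge_0 | exact HM].
Qed.

(** The remainder estimate of [pow_inv_taylor_bound] is uniform in [t], so it can be integrated
    against the bounded weight [phi]. *)
Lemma is_cderiv_cauchy_int (phi zeta : R -> C) (a b d : R) (n : nat) (w : C) :
  (a <= b)%R -> (0 < d)%R ->
  (forall t, continuous phi t) -> (forall t, continuous zeta t) ->
  (forall t, (d <= Cmod (zeta t - w))%R) ->
  is_cderiv (cauchy_int phi zeta a b n) w
    (RtoC (INR n) * cauchy_int phi zeta a b (S n) w).
Proof.
  intros Hab Hd Hp Hz Hw.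
  destruct (continuous_bounded phi a b Hab Hp) as [B [HB0 HB]].
  (* For [Cmod h < d / 2] the curve keeps distance at least [d / 2] from [w + h] as well, so both
     inverses are bounded by [2 / d]. *)
  destruct (pow_inv_taylor_bound (2 / d) n) as [K [HK0 HK]].
  { apply Rlt_le, Rdiv_lt_0_compat; lra. }
  assert (Hr : (0 < d / 2)%R) by lra.
  apply (is_cderiv_quadratic _ _ _ (mkposreal _ Hr) (2 * ((b - a) * (B * K)))%R).
  intros h Hh; simpl in Hh.
  assert (NZ : forall x : C, (0 < Cmod x)%R -> x <> 0)
    by (intros x Hx; apply Cmod_gt_0; exact Hx).
  assert (Hwh : forall t, (d / 2 <= Cmod (zeta t - (w + h)))%R).
  { intros t; replace (zeta t - (w + h)) with ((zeta t - w) - h) by ring.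
    pose proof (Cmod_triangle_minus (zeta t - w) h); specialize (Hw t); lra. }
  assert (N1 : forall t, zeta t - w <> 0)
    by (intros t; apply NZ; specialize (Hw t); lra).
  assert (N2 : forall t, zeta t - (w + h) <> 0)
    by (intros t; apply NZ; specialize (Hwh t); lra).
  assert (IB : forall x : C, (d / 2 <= Cmod x)%R -> (Cmod (/ x) <= 2 / d)%R).
  { intros x Hx; rewrite Cmod_inv by (apply NZ; lra).
    replace (2 / d)%R with (/ (d / 2))%R by (field; lra).
    apply Rinv_le_contravar; assumption. }
  set (P := fun t => phi t * (/ (zeta t - (w + h))) ^ n).
  set (Q := fun t => phi t * (/ (zeta t - w)) ^ n).
  set (Q' := fun t => phi t * (/ (zeta t - w)) ^ S n).
  assert (CP : forall t, continuous P t)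
    by (intros t; apply continuous_cauchy_integrand; assumption).
  assert (CQ : forall t, continuous Q t)
    by (intros t; apply continuous_cauchy_integrand; assumption).
  assert (CS : forall t, continuous Q' t)
    by (intros t; apply continuous_cauchy_integrand; assumption).
  assert (CS1 : forall t, continuous (fun t => RtoC (INR n) * Q' t) t)
    by (intros t; apply (continuous_Cmult (fun _ => RtoC (INR n)) Q');
        [apply continuous_const | apply CS]).
  assert (CS2 : forall t, continuous (fun t => h * (RtoC (INR n) * Q' t)) t)
    by (intros t; apply (continuous_Cmult (fun _ => h) (fun t => RtoC (INR n) * Q' t));
        [apply continuous_const | apply CS1]).
  assert (CPQ : forall t, continuous (fun t => P t - Q t) t)
    by (intros t; apply continuous_Cminus; [apply CP | apply CQ]).
  change (cauchy_int phi zeta a b n (w + h)) with (CInt P a b).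
  change (cauchy_int phi zeta a b n w) with (CInt Q a b).
  change (cauchy_int phi zeta a b (S n) w) with (CInt Q' a b).
  rewrite <- (CInt_minus P Q) by assumption.
  rewrite <- (CInt_scal (RtoC (INR n)) Q') by assumption.
  rewrite <- (CInt_scal h (fun t => RtoC (INR n) * Q' t)) by assumption.
  rewrite <- (CInt_minus (fun t => P t - Q t) (fun t => h * (RtoC (INR n) * Q' t)))
    by assumption.
  replace (2 * ((b - a) * (B * K)) * Cmod h ^ 2)%R
    with (2 * ((b - a) * (B * (K * Cmod h ^ 2))))%R by ring.
  apply Cmod_CInt_le; [assumption | |].
  - intros t; apply (continuous_Cminus (fun t => P t - Q t)); [apply CPQ | apply CS2].
  - intros t Ht; unfold P, Q, Q'.
    replace (phi t * (/ (zeta t - (w + h))) ^ n - phi t * (/ (zeta t - w)) ^ n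
             - h * (RtoC (INR n) * (phi t * (/ (zeta t - w)) ^ S n)))
      with (phi t * ((/ (zeta t - w - h)) ^ n - (/ (zeta t - w)) ^ n
             - h * (RtoC (INR n) * (/ (zeta t - w)) ^ S n))).
    2: { replace (zeta t - (w + h)) with (zeta t - w - h) by ring. ring. }
    rewrite Cmod_mult; apply Rmult_le_compat; try apply Cmod_ge_0; [apply HB, Ht|].
    specialize (Hwh t); specialize (N2 t).
    replace (zeta t - (w + h)) with (zeta t - w - h) in Hwh, N2 by ring.
    apply HK; auto. apply IB; specialize (Hw t); lra.
Qed.

(** * The Cauchy formula *)

Definition is_curve_deriv (g : R -> C) (t : R) (d : C) : Prop :=
  is_derive (fun s => Re (g s)) t (Re d) /\ is_derive (fun s => Im (g s)) t (Im d).

Lemma is_curve_deriv_comp (F : C -> C) (g : R -> C) (t : R) (d l : C) :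
  is_cderiv F (g t) l -> is_curve_deriv g t d ->
  is_curve_deriv (fun s => F (g s)) t (l * d).
Proof.
  intros HF [H1 H2].
  rewrite (surjective_pairing (g t)) in HF.
  destruct (is_cderiv_curve F (fun s => fst (g s)) (fun s => snd (g s)) t
              (Re d) (Im d) l HF H1 H2) as [A B].
  destruct d; simpl in *.
  split; [refine (is_derive_ext _ _ _ _ _ A) | refine (is_derive_ext _ _ _ _ _ B)];
    intros s; simpl; rewrite <- surjective_pairing; reflexivity.
Qed.

Lemma is_curve_deriv_mult_r (g : R -> C) (t : R) (d c : C) :
  is_curve_deriv g t d -> is_curve_deriv (fun s => g s * c) t (d * c).
Proof.
  intros [H1 H2]; split.
  - apply (is_derive_minus (V := R_NormedModule)
      (fun s => Re (g s) * Re c)%R (fun s => Im (g s) * Im c)%R).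
    + apply (is_derive_ext (fun s => Re c * Re (g s))%R);
        [intros; apply Rmult_comm|].
      rewrite Rmult_comm; apply is_derive_scal; exact H1.
    + apply (is_derive_ext (fun s => Im c * Im (g s))%R);
        [intros; apply Rmult_comm|].
      rewrite Rmult_comm; apply is_derive_scal; exact H2.
  - apply (is_derive_plus (V := R_NormedModule)
      (fun s => Re (g s) * Im c)%R (fun s => Im (g s) * Re c)%R).
    + apply (is_derive_ext (fun s => Im c * Re (g s))%R);
        [intros; apply Rmult_comm|].
      rewrite Rmult_comm; apply is_derive_scal; exact H1.
    + apply (is_derive_ext (fun s => Re c * Im (g s))%R);
        [intros; apply Rmult_comm|].
      rewrite Rmult_comm; apply is_derive_scal; exact H2.
Qed.

Lemma CInt_curve_deriv (G g : R -> C) (a b : R) :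
  (forall t, is_curve_deriv G t (g t)) -> (forall t, continuous g t) ->
  CInt g a b = G b - G a.
Proof.
  intros HG Hg; unfold CInt, Cminus, Cplus, Copp; f_equal;
    apply (is_RInt_unique (V := R_CompleteNormedModule)).
  - apply (is_RInt_derive (V := R_CompleteNormedModule) (fun t => Re (G t)));
      intros t _; [apply HG | apply continuous_Re, Hg].
  - apply (is_RInt_derive (V := R_CompleteNormedModule) (fun t => Im (G t)));
      intros t _; [apply HG | apply continuous_Im, Hg].
Qed.

(** The interval from -1 to 2 has 0 and 1 in its interior, so two-sided derivatives exist at both
    ends. The integral of [dp s] is asked to vanish only for [0 < s < 1], because in the application
    this is obtained by dividing by [s]. *)
Lemma RInt_param_const (p dp : R -> R -> R) (a b : R) :
  (forall s t, (-1 < s < 2)%R -> is_derive (fun u => p u t) s (dp s t)) ->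
  (forall s t, (-1 < s < 2)%R ->
     continuous (fun z : R * R => dp (fst z) (snd z)) (s, t)) ->
  (forall s t, (-1 < s < 2)%R -> continuous (p s) t) ->
  (forall s, (0 < s < 1)%R -> RInt (dp s) a b = 0%R) ->
  RInt (p 0%R) a b = RInt (p 1%R) a b.
Proof.
  intros Hp Hc Hi H0.
  assert (L : forall s, (-1 < s < 2)%R ->
    locally s (fun y : R => (-1 < y < 2)%R)).
  { intros s Hs; assert (Hd : (0 < Rmin (s + 1) (2 - s))%R) by (apply Rmin_pos; lra).
    exists (mkposreal _ Hd); intros y Hy; simpl in Hy.
    unfold ball in Hy; simpl in Hy; unfold AbsRing_ball, abs, minus, plus, opp in Hy;
      simpl in Hy.
    pose proof (Rmin_l (s + 1) (2 - s)); pose proof (Rmin_r (s + 1) (2 - s)).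
    apply Rabs_def2 in Hy; lra. }
  assert (HD : forall s, (-1 < s < 2)%R ->
    is_derive (fun u => RInt (p u) a b) s (RInt (dp s) a b)).
  { intros s Hs.
    replace (RInt (dp s) a b) with (RInt (fun t => Derive (fun u => p u t) s) a b).
    2: { apply RInt_ext; intros t _; apply is_derive_unique, Hp, Hs. }
    apply (is_derive_RInt_param p).
    - apply filter_imp with (2 := L s Hs); intros y Hy t _; eexists; apply Hp, Hy.
    - intros t _; apply (continuity_2d_pt_ext_loc dp).
      + destruct (L s Hs) as [d Hd]; exists d; intros u v Hu _.
        symmetry; apply is_derive_unique, Hp, Hd; exact Hu.
      + apply continuity_2d_pt_filterlim; exact (Hc s t Hs).
    - apply filter_imp with (2 := L s Hs); intros y Hy.
      apply (ex_RInt_continuous (V := R_CompleteNormedModule)); intros t _.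
      apply Hi, Hy. }
  (* [MVT_gen] yields [c] in the closed interval, so the derivative function is given the default 0
     at the endpoints, about which [H0] says nothing. *)
  destruct (MVT_gen (fun u => RInt (p u) a b) 0 1 (fun s => if Rlt_dec 0 s then
     if Rlt_dec s 1 then RInt (dp s) a b else 0%R else 0%R)) as [c [_ Hc']].
  - rewrite Rmin_left, Rmax_right by lra; intros s Hs.
    destruct (Rlt_dec 0 s); [|lra]; destruct (Rlt_dec s 1); [|lra].
    apply HD; lra.
  - rewrite Rmin_left, Rmax_right by lra; intros s Hs.
    apply continuity_pt_filterlim.
    apply (ex_derive_continuous (V := R_NormedModule) (fun u => RInt (p u) a b)).
    eexists; apply HD; lra.
  - destruct (Rlt_dec 0 c); [destruct (Rlt_dec c 1)|]; [rewrite H0 in Hc' by lra| |]; lra.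
Qed.

Lemma CInt_param_const (p dp : R -> R -> C) (a b : R) :
  (forall s t, (-1 < s < 2)%R -> is_curve_deriv (fun u => p u t) s (dp s t)) ->
  (forall s t, (-1 < s < 2)%R ->
     continuous (fun z : R * R => dp (fst z) (snd z)) (s, t)) ->
  (forall s t, (-1 < s < 2)%R -> continuous (p s) t) ->
  (forall s, (0 < s < 1)%R -> CInt (dp s) a b = 0) ->
  CInt (p 0%R) a b = CInt (p 1%R) a b.
Proof.
  intros Hp Hc Hi H0; unfold CInt; f_equal.
  - apply (RInt_param_const (fun s t => Re (p s t)) (fun s t => Re (dp s t))).
    + intros s t Hs; apply (Hp s t Hs).
    + intros s t Hs; apply (continuous_Re (fun z : R * R => dp (fst z) (snd z))), Hc, Hs.
    + intros s t Hs; apply continuous_Re, Hi, Hs.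
    + intros s Hs; exact (f_equal Re (H0 s Hs)).
  - apply (RInt_param_const (fun s t => Im (p s t)) (fun s t => Im (dp s t))).
    + intros s t Hs; apply (Hp s t Hs).
    + intros s t Hs; apply (continuous_Im (fun z : R * R => dp (fst z) (snd z))), Hc, Hs.
    + intros s t Hs; apply continuous_Im, Hi, Hs.
    + intros s Hs; exact (f_equal Im (H0 s Hs)).
Qed.

Definition circle (r t : R) : C := (r * cos t, r * sin t)%R.

Lemma Cmod_circle (r t : R) : (0 < r)%R -> Cmod (circle r t) = r.
Proof.
  intros Hr; unfold circle, Cmod; simpl.
  replace (r * cos t * (r * cos t * 1) + r * sin t * (r * sin t * 1))%R with (r * r)%R.
  - apply sqrt_square; lra.
  - pose proof (sin2_cos2 t) as H; unfold Rsqr in H.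
    transitivity (r * r * (sin t * sin t + cos t * cos t))%R; [rewrite H|]; ring.
Qed.

Lemma circle_periodic (r : R) : circle r (2 * PI) = circle r 0.
Proof. unfold circle; rewrite cos_2PI, sin_2PI, cos_0, sin_0; reflexivity. Qed.

Lemma is_curve_deriv_circle (r t : R) : is_curve_deriv (circle r) t (Ci * circle r t).
Proof.
  split; unfold circle; simpl; auto_derive; auto; ring.
Qed.

Lemma is_curve_deriv_continuous (g : R -> C) (t : R) (d : C) :
  is_curve_deriv g t d -> continuous g t.
Proof.
  intros [H1 H2]; apply continuous_C;
    apply (ex_derive_continuous (V := R_NormedModule)); eexists; eassumption.
Qed.

Lemma is_curve_deriv_affine (c m : C) (g : R -> C) (t : R) (d : C) :
  is_curve_deriv g t d -> is_curve_deriv (fun s => c + g s * m) t (d * m).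
Proof.
  intros H; apply (is_curve_deriv_mult_r _ _ _ m) in H; destruct H as [H1 H2].
  split.
  - rewrite <- (Rplus_0_l (Re (d * m))).
    apply (is_derive_plus (V := R_NormedModule) (fun _ => Re c));
      [exact (is_derive_const (K := R_AbsRing) (V := R_NormedModule) _ _) | exact H1].
  - rewrite <- (Rplus_0_l (Im (d * m))).
    apply (is_derive_plus (V := R_NormedModule) (fun _ => Im c));
      [exact (is_derive_const (K := R_AbsRing) (V := R_NormedModule) _ _) | exact H2].
Qed.

Lemma is_curve_deriv_RtoC (t : R) : is_curve_deriv RtoC t 1.
Proof.
  split; simpl.
  - exact (is_derive_id (K := R_AbsRing) t).
  - exact (is_derive_const (K := R_AbsRing) (V := R_NormedModule) _ _).
Qed.

Lemma is_cderiv_Cinv (z : C) : z <> 0 -> is_cderiv Cinv z (- (/ z) ^ 2).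
Proof.
  intros Hz; assert (Hm : (0 < Cmod z)%R) by (apply Cmod_gt_0; exact Hz).
  assert (Hr : (0 < Cmod z / 2)%R) by lra.
  destruct (pow_inv_taylor_bound (2 / Cmod z) 1) as [K [HK0 HK]].
  { apply Rlt_le, Rdiv_lt_0_compat; lra. }
  apply (is_cderiv_quadratic _ _ _ (mkposreal _ Hr) K); simpl (pos _); intros h Hh.
  pose proof (Cmod_triangle_minus z (- h)) as T; rewrite Cmod_opp in T.
  assert (N : z - - h <> 0) by (apply Cmod_gt_0; lra).
  specialize (HK z (- h) Hz N).
  rewrite Cmod_opp, !Cpow_1_r in HK.
  replace (z - - h) with (z + h) in * by ring.
  replace (/ (z + h) - / z - h * - (/ z) ^ 2)
    with (/ (z + h) - / z - - h * (RtoC (INR 1) * (/ z) ^ 2))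
    by (simpl; ring).
  apply HK; rewrite Cmod_inv by assumption.
  - unfold Rdiv; rewrite <- (Rmult_1_l (/ Cmod z)) at 1.
    apply Rmult_le_compat_r; [apply Rlt_le, Rinv_0_lt_compat|]; lra.
  - replace (2 / Cmod z)%R with (/ (Cmod z / 2))%R by (field; lra).
    apply Rinv_le_contravar; lra.
Qed.

(** For [x] on the circle and [y = 1 / (zeta - w) ^ 2], the right-hand side is literally what the
    chain rule yields as derivative of [/ (zeta t - w) * Ci]. *)
Lemma Ci_rotate (x y : C) : x * y = - y * (Ci * x * 1) * Ci.
Proof.
  transitivity (- (Ci * Ci) * (x * y)); [|ring].
  replace (- (Ci * Ci)) with (RtoC 1); [ring|].
  unfold Ci, Cmult, Copp, RtoC; simpl; f_equal; ring.
Qed.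

Section Circle.
Variables (z0 : C) (r : R).
Hypothesis r_pos : (0 < r)%R.

(* The factor 1 gives [zeta] the shape of [is_curve_deriv_affine]. *)
Let zeta (t : R) : C := z0 + circle r t * 1.

Lemma continuous_circle t : continuous (circle r) t.
Proof. eapply is_curve_deriv_continuous, is_curve_deriv_circle. Qed.

Lemma is_curve_deriv_zeta t : is_curve_deriv zeta t (Ci * circle r t * 1).
Proof. apply is_curve_deriv_affine, is_curve_deriv_circle. Qed.

Lemma continuous_zeta t : continuous zeta t.
Proof. eapply is_curve_deriv_continuous, is_curve_deriv_zeta. Qed.

Lemma zeta_dist w t : (r - Cmod (w - z0) <= Cmod (zeta t - w))%R.
Proof.
  replace (zeta t - w) with (circle r t - (w - z0)) by (unfold zeta; ring).
  pose proof (Cmod_triangle_minus (circle r t) (w - z0)) as H.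
  rewrite Cmod_circle in H; assumption.
Qed.

Lemma zeta_neq w t : (Cmod (w - z0) < r)%R -> zeta t - w <> 0.
Proof. intros H; apply Cmod_gt_0; pose proof (zeta_dist w t); lra. Qed.

(** The integrand has the periodic primitive [Ci / (zeta t - w)]. *)
Lemma cauchy_int_circle_2 w :
  (Cmod (w - z0) < r)%R ->
  cauchy_int (circle r) zeta 0 (2 * PI) 2 w = 0.
Proof.
  intros Hw; unfold cauchy_int.
  rewrite (CInt_ext _ (fun t => - (/ (zeta t - w)) ^ 2 * (Ci * circle r t * 1) * Ci)).
  2: { intros t; apply Ci_rotate. }
  rewrite (CInt_curve_deriv (fun t => / (zeta t - w) * Ci)).
  - unfold zeta; rewrite circle_periodic; ring.
  - intros t; apply is_curve_deriv_mult_r.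
    apply (is_curve_deriv_comp Cinv (fun t => zeta t - w)).
    + apply is_cderiv_Cinv, zeta_neq, Hw.
    + destruct (is_curve_deriv_affine (z0 - w) 1 _ _ _ (is_curve_deriv_circle r t)) as [A B].
      split; [refine (is_derive_ext _ _ _ _ _ A) | refine (is_derive_ext _ _ _ _ _ B)];
      intros s; unfold zeta; simpl; ring.
  - intros t.
    apply (continuous_ext (fun t => circle r t * (/ (zeta t - w)) ^ 2)).
    { intros s; apply Ci_rotate. }
    apply continuous_cauchy_integrand.
    + apply continuous_circle.
    + apply continuous_zeta.
    + intros; apply zeta_neq, Hw.
Qed.

(** The derivative in [w] is the integral with exponent 2, which vanishes. The value is therefore
    the one at the centre, where the integrand is 1. *)
Lemma cauchy_int_circle_1 w :
  (Cmod (w - z0) < r)%R ->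
  cauchy_int (circle r) zeta 0 (2 * PI) 1 w = RtoC (2 * PI).
Proof.
  intros Hw; set (J := cauchy_int (circle r) zeta 0 (2 * PI) 1).
  assert (J0 : J z0 = RtoC (2 * PI)).
  { unfold J, cauchy_int. rewrite (CInt_ext _ (fun _ => 1)).
    - unfold CInt; simpl; rewrite !RInt_const; unfold scal; simpl; unfold mult; simpl.
      unfold RtoC; f_equal; ring.
    - intros t; rewrite Cpow_1_r; unfold zeta.
      replace (z0 + circle r t * 1 - z0) with (circle r t) by ring.
      apply Cinv_r, Cmod_gt_0; rewrite Cmod_circle; assumption. }
  rewrite <- J0.
  set (g := fun s : R => J (z0 + RtoC s * (w - z0))).
  assert (Hg : forall s, (0 <= s <= 1)%R -> is_curve_deriv g s 0).
  { intros s Hs.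
    assert (Hs' : (Cmod (z0 + RtoC s * (w - z0) - z0) < r)%R).
    { replace (z0 + RtoC s * (w - z0) - z0) with (RtoC s * (w - z0)) by ring.
      rewrite Cmod_mult, Cmod_R, Rabs_pos_eq by lra.
      pose proof (Cmod_ge_0 (w - z0)); nra. }
    (* 0 is put in the shape delivered by the chain rule: the exponent, the vanishing integral with
       exponent 2, the velocity of the segment. *)
    replace (RtoC 0) with (RtoC (INR 1) * RtoC 0 * (1 * (w - z0))) by ring.
    apply (is_curve_deriv_comp J (fun s => z0 + RtoC s * (w - z0))).
    - unfold J. rewrite <- (cauchy_int_circle_2 _ Hs').
      apply (is_cderiv_cauchy_int _ _ _ _ (r - Cmod (z0 + RtoC s * (w - z0) - z0))).
      + pose proof PI_RGT_0; lra.
      + lra.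
      + apply continuous_circle.
      + apply continuous_zeta.
      + apply zeta_dist.
    - apply is_curve_deriv_affine, is_curve_deriv_RtoC. }
  replace (J w) with (g 1%R) by (unfold g; f_equal; ring).
  replace (J z0) with (g 0%R) by (unfold g; f_equal; ring).
  (* The mean value theorem holds for real functions only, so it is applied to each coordinate. *)
  assert (E : forall pr : C -> R,
    (forall s, (0 <= s <= 1)%R -> is_derive (fun u => pr (g u)) s 0%R) ->
    pr (g 1%R) = pr (g 0%R)).
  { intros pr H; destruct (MVT_gen (fun u => pr (g u)) 0 1 (fun _ => 0%R)) as [c [_ Hc]].
    - rewrite Rmin_left, Rmax_right by lra; intros s Hs; apply H; lra.
    - rewrite Rmin_left, Rmax_right by lra; intros s Hs.
      apply continuity_pt_filterlim.
      apply (ex_derive_continuous (V := R_NormedModule) (fun u => pr (g u))).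
      eexists; apply H, Hs.
    - lra. }
  apply injective_projections; apply E; intros s Hs; apply (Hg s Hs).
Qed.

(** Since [d zeta = Ci * circle r t dt], the right-hand side is the usual integral of
    [F (zeta) / (zeta - w)] divided by [2 PI Ci]. *)
Lemma cauchy_formula (F : C -> C) (w : C) :
  holomorphic (fun z => (Cmod (z - z0) < 5 * r)%R) F ->
  (Cmod (w - z0) < r)%R ->
  F w = cauchy_int (fun t => RtoC (/ (2 * PI)) * (F (zeta t) * circle r t))
          zeta 0 (2 * PI) 1 w.
Proof.
  intros HF Hw.
  pose proof PI_RGT_0 as Hpi.
  set (K := fun t => circle r t * / (zeta t - w)).
  set (gam := fun s t => w + RtoC s * (zeta t - w)).
  assert (HK : forall t, continuous K t).
  { intros t; apply (continuous_ext (fun t => circle r t * (/ (zeta t - w)) ^ 1)).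
    { intros s; rewrite Cpow_1_r; reflexivity. }
    apply continuous_cauchy_integrand;
      [apply continuous_circle | apply continuous_zeta | intros; apply zeta_neq, Hw]. }
  (* Origin of the constant 5: [w] is within [r] of the centre, [zeta t - w] is shorter than
     [2 * r], and [Rabs s <= 2]. *)
  assert (Hgam : forall s t, (-1 < s < 2)%R -> (Cmod (gam s t - z0) < 5 * r)%R).
  { intros s t Hs; unfold gam.
    replace (w + RtoC s * (zeta t - w) - z0)
      with ((w - z0) + RtoC s * (circle r t + - (w - z0))) by (unfold zeta; ring).
    eapply Rle_lt_trans; [apply Cmod_triangle|].
    rewrite Cmod_mult, Cmod_R.
    assert ((Cmod (circle r t + - (w - z0)) < 2 * r)%R).
    { eapply Rle_lt_trans; [apply Cmod_triangle|].
      rewrite Cmod_opp, Cmod_circle by assumption; lra. }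
    assert (Rabs s <= 2)%R by (apply Rabs_le; lra).
    pose proof (Cmod_ge_0 (circle r t + - (w - z0))).
    pose proof (Rabs_pos s). nra. }
  assert (Hgc : forall s t, continuous (fun z : R * R => gam (fst z) (snd z)) (s, t)).
  { intros s t; unfold gam.
    apply (continuous_Cplus (fun _ => w)); [apply continuous_const|].
    apply (continuous_Cmult (fun z : R * R => RtoC (fst z)) (fun z => zeta (snd z) - w)).
    - apply continuous_C; [apply continuous_fst | apply continuous_const].
    - apply (continuous_Cminus (fun z : R * R => zeta (snd z)) (fun _ => w));
        [|apply continuous_const].
      apply (continuous_comp snd zeta); [apply continuous_snd | apply continuous_zeta]. }
  assert (Hgc1 : forall s t, continuous (gam s) t).
  { intros s t; apply (continuous_Cplus (fun _ => w)); [apply continuous_const|].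
    apply (continuous_Cmult (fun _ => RtoC s)); [apply continuous_const|].
    apply continuous_Cminus; [apply continuous_zeta | apply continuous_const]. }
  assert (P : CInt (fun t => F (gam 0%R t) * K t) 0 (2 * PI)
              = CInt (fun t => F (gam 1%R t) * K t) 0 (2 * PI)).
  { apply (CInt_param_const (fun s t => F (gam s t) * K t)
      (fun s t => cderiv F (gam s t) * circle r t)).
    - intros s t Hs.
      (* The factor [zeta t - w] from the chain rule cancels the denominator of [K], which leaves an
         integrand without singularity. *)
      replace (cderiv F (gam s t) * circle r t)
        with (cderiv F (gam s t) * (1 * (zeta t - w)) * K t)
        by (unfold K; field; apply zeta_neq, Hw).
      apply is_curve_deriv_mult_r.
      apply (is_curve_deriv_comp F (fun s => gam s t)).
      + apply HF, Hgam, Hs.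
      + apply (is_curve_deriv_affine w (zeta t - w)), is_curve_deriv_RtoC.
    - intros s t Hs.
      apply (continuous_Cmult (fun z : R * R => cderiv F (gam (fst z) (snd z)))
               (fun z => circle r (snd z))).
      + apply (continuous_comp (fun z : R * R => gam (fst z) (snd z)) (cderiv F));
          [apply Hgc | apply HF, Hgam, Hs].
      + apply (continuous_comp snd (circle r)); [apply continuous_snd | apply continuous_circle].
    - intros s t Hs; apply (continuous_Cmult (fun t => F (gam s t)) K); [|apply HK].
      apply (continuous_comp (gam s) F); [apply Hgc1|].
      eapply is_cderiv_continuous, HF, Hgam, Hs.
    - intros s Hs.
      assert (Hs' : (-1 < s < 2)%R) by lra.
      assert (Cd : forall t, continuous (fun t => cderiv F (gam s t) * circle r t) t).
      { intros t; apply (continuous_Cmult (fun t => cderiv F (gam s t)));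
          [|apply continuous_circle].
        apply (continuous_comp (gam s) (cderiv F)); [apply Hgc1 | apply HF, Hgam, Hs']. }
      (* The velocity of [gam s] is [s * Ci * circle r t]. Multiplied by [s * Ci], the integrand is
         thus the derivative of [F (gam s t)] along a closed curve. *)
      assert (E : RtoC s * Ci * CInt (fun t => cderiv F (gam s t) * circle r t) 0 (2 * PI) = 0).
      { rewrite <- CInt_scal by exact Cd.
        rewrite (CInt_curve_deriv (fun t => F (gam s t))).
        - unfold gam, zeta; rewrite circle_periodic; ring.
        - intros t.
          replace (RtoC s * Ci * (cderiv F (gam s t) * circle r t))
            with (cderiv F (gam s t) * (Ci * circle r t * RtoC s)) by ring.
          apply (is_curve_deriv_comp F (gam s)); [apply HF, Hgam, Hs'|].
          destruct (is_curve_deriv_affine (w + RtoC s * (z0 - w)) (RtoC s) _ _ _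
                      (is_curve_deriv_circle r t)) as [A B].
          split; [refine (is_derive_ext _ _ _ _ _ A) | refine (is_derive_ext _ _ _ _ _ B)];
          intros u; f_equal; unfold gam, zeta; ring.
        - intros t; apply (continuous_Cmult (fun _ => RtoC s * Ci));
            [apply continuous_const | apply Cd]. }
      assert (N : RtoC s * Ci <> 0).
      { apply Cmult_neq_0; [intros E0; apply RtoC_inj in E0; lra | apply Cmod_gt_0; rewrite Cmod_Ci; lra]. }
      transitivity (/ (RtoC s * Ci) *
        (RtoC s * Ci * CInt (fun t => cderiv F (gam s t) * circle r t) 0 (2 * PI)));
        [rewrite Cmult_assoc, Cinv_l by exact N; ring | rewrite E; ring]. }
  rewrite (CInt_ext _ (fun t => F w * K t)) in P.
  2: { intros t; unfold gam; replace (w + RtoC 0 * (zeta t - w)) with w by ring; reflexivity. }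
  rewrite CInt_scal in P by exact HK.
  pose proof (cauchy_int_circle_1 w Hw) as J; unfold cauchy_int in J.
  rewrite (CInt_ext _ K) in J by (intros t; rewrite Cpow_1_r; reflexivity).
  rewrite J in P.
  assert (Cz : forall t, continuous (fun t => F (gam 1%R t) * K t) t).
  { intros t; apply (continuous_Cmult (fun t => F (gam 1%R t)) K); [|apply HK].
    apply (continuous_comp (gam 1%R) F); [apply Hgc1|].
    eapply is_cderiv_continuous, HF, Hgam; lra. }
  unfold cauchy_int.
  rewrite (CInt_ext _ (fun t => RtoC (/ (2 * PI)) * (F (gam 1%R t) * K t))).
  - rewrite CInt_scal by exact Cz.
    rewrite <- P; transitivity (RtoC (/ (2 * PI) * (2 * PI)) * F w).
    + rewrite Rinv_l by lra; ring.
    + rewrite RtoC_mult; ring.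
  - intros t; unfold gam, K; rewrite Cpow_1_r.
    replace (w + 1 * (zeta t - w)) with (zeta t) by ring; ring.
Qed.

End Circle.

(** Near [z0], [F] is a Cauchy integral with exponent 1, so its derivative is the one with exponent
    2, and the second derivative is twice the one with exponent 3, which is again differentiable and
    hence continuous. *)
Theorem holomorphic_cderiv (D : C -> Prop) (F : C -> C) :
  open D -> holomorphic D F -> holomorphic D (cderiv F).
Proof.
  intros HO HF z0 Hz0.
  destruct (locally_Cmod_ex z0 D (HO z0 Hz0)) as [rho Hrho].
  (* [cauchy_formula] asks for holomorphy on the disc of radius [5 * r]. *)
  set (r := (rho / 5)%R).
  assert (r_pos : (0 < r)%R) by (unfold r; destruct rho; simpl; lra).
  set (zeta := fun t : R => z0 + circle r t * 1).
  set (phi := fun t => RtoC (/ (2 * PI)) * (F (zeta t) * circle r t)).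
  set (Phi := cauchy_int phi zeta 0 (2 * PI)).
  assert (HF' : holomorphic (fun z => (Cmod (z - z0) < 5 * r)%R) F).
  { intros z Hz; apply HF, Hrho; unfold r in Hz; lra. }
  assert (Hphi : forall t, continuous phi t).
  { intros t; apply (continuous_Cmult (fun _ => RtoC (/ (2 * PI)))); [apply continuous_const|].
    apply (continuous_Cmult (fun t => F (zeta t)) (circle r)); [|apply continuous_circle].
    apply (continuous_comp zeta F); [apply continuous_zeta|].
    eapply is_cderiv_continuous, HF'.
    replace (zeta t - z0) with (circle r t) by (unfold zeta; ring).
    rewrite Cmod_circle by assumption; lra. }
  assert (L : forall w, (Cmod (w - z0) < r)%R ->
                locally w (fun u => (Cmod (u - z0) < r)%R)).
  { intros w Hw; assert (Hd : (0 < r - Cmod (w - z0))%R) by lra.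
    apply (locally_Cmod_lt w (mkposreal _ Hd)); simpl; intros u Hu.
    replace (u - z0) with ((u - w) + (w - z0)) by ring.
    eapply Rle_lt_trans; [apply Cmod_triangle|]; lra. }
  assert (HPhi : forall n w, (Cmod (w - z0) < r)%R ->
    is_cderiv (Phi n) w (RtoC (INR n) * Phi (S n) w)).
  { intros n w Hw; apply (is_cderiv_cauchy_int _ _ _ _ (r - Cmod (w - z0))).
    - pose proof PI_RGT_0; lra.
    - lra.
    - exact Hphi.
    - apply continuous_zeta.
    - apply zeta_dist; assumption. }
  assert (E1 : forall w, (Cmod (w - z0) < r)%R -> F w = Phi 1%nat w)
    by (intros w Hw; apply cauchy_formula; assumption).
  assert (E2 : forall w, (Cmod (w - z0) < r)%R -> cderiv F w = Phi 2%nat w).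
  { intros w Hw; apply is_cderiv_unique, (is_cderiv_ext_loc (Phi 1%nat)).
    - apply filter_imp with (2 := L w Hw); intros u Hu; symmetry; apply E1, Hu.
    - replace (Phi 2%nat w) with (RtoC (INR 1) * Phi 2%nat w) by (simpl; ring).
      apply HPhi, Hw. }
  assert (E3 : forall w, (Cmod (w - z0) < r)%R ->
    is_cderiv (cderiv F) w (RtoC (INR 2) * Phi 3%nat w)).
  { intros w Hw; apply (is_cderiv_ext_loc (Phi 2%nat)); [|apply HPhi, Hw].
    apply filter_imp with (2 := L w Hw); intros u Hu; symmetry; apply E2, Hu. }
  assert (Hc : (Cmod (z0 - z0) < r)%R).
  { replace (z0 - z0) with (RtoC 0) by ring; rewrite Cmod_0; assumption. }
  split.
  - rewrite (is_cderiv_unique _ _ _ (E3 z0 Hc)); apply E3, Hc.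
  - apply (continuous_ext_loc _ (fun w => RtoC (INR 2) * Phi 3%nat w)).
    + apply filter_imp with (2 := L z0 Hc); intros w Hw.
      symmetry; apply is_cderiv_unique, E3, Hw.
    + apply (continuous_Cmult (fun _ => RtoC (INR 2))); [apply continuous_const|].
      eapply is_cderiv_continuous, HPhi, Hc.
Qed.

Local Open Scope R_scope.

(** * Derivations on smooth quaternionic functions *)

Definition pd_alpha (u : C -> R) (z : C) : R := Derive (fun a => u (a, Im z)) (Re z).
Definition pd_beta (u : C -> R) (z : C) : R := Derive (fun b => u (Re z, b)) (Im z).

(* Replaces [C^infinity]: it suffices that the class is closed under [d/dbeta] and
   the algebra operations, and that its members have partial derivatives on [D]. *)
Inductive smooth (D : C -> Prop) : (C -> R) -> Prop :=
| smooth_Re F : holomorphic D F -> smooth D (fun z => Re (F z))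
| smooth_Im F : holomorphic D F -> smooth D (fun z => Im (F z))
| smooth_inv_Im : smooth D (fun z => / Im z)
| smooth_const c : smooth D (fun _ => c)
| smooth_plus u v : smooth D u -> smooth D v -> smooth D (fun z => u z + v z)
| smooth_mult u v : smooth D u -> smooth D v -> smooth D (fun z => u z * v z)
| smooth_ext u v : (forall z, D z -> u z = v z) -> smooth D u -> smooth D v.

Section Smooth.
Variable D : C -> Prop.
Hypothesis D_open : open D.
Hypothesis D_nonreal : forall z, D z -> Im z <> 0.

Lemma is_derive_alpha_ext (u v : C -> R) (z : C) (l : R) :
  (forall w, D w -> u w = v w) -> D z ->
  is_derive (fun a => u (a, Im z)) (Re z) l -> is_derive (fun a => v (a, Im z)) (Re z) l.
Proof.
  intros E Hz; apply is_derive_ext_loc.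
  apply filter_imp with (2 := proj1 (locally_slices D z D_open Hz)); intros a Ha.
  apply E, Ha.
Qed.

Lemma is_derive_beta_ext (u v : C -> R) (z : C) (l : R) :
  (forall w, D w -> u w = v w) -> D z ->
  is_derive (fun b => u (Re z, b)) (Im z) l -> is_derive (fun b => v (Re z, b)) (Im z) l.
Proof.
  intros E Hz; apply is_derive_ext_loc.
  apply filter_imp with (2 := proj2 (locally_slices D z D_open Hz)); intros a Ha.
  apply E, Ha.
Qed.

Lemma pd_beta_ext (u v : C -> R) (z : C) :
  (forall w, D w -> u w = v w) -> D z -> pd_beta u z = pd_beta v z.
Proof.
  intros E Hz; apply Derive_ext_loc.
  apply filter_imp with (2 := proj2 (locally_slices D z D_open Hz)); intros a Ha.
  apply E, Ha.
Qed.

Lemma pd_alpha_ext (u v : C -> R) (z : C) :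
  (forall w, D w -> u w = v w) -> D z -> pd_alpha u z = pd_alpha v z.
Proof.
  intros E Hz; apply Derive_ext_loc.
  apply filter_imp with (2 := proj1 (locally_slices D z D_open Hz)); intros a Ha.
  apply E, Ha.
Qed.

(** Induction on the generators. In the holomorphic cases the [beta]-derivatives of [Re F] and
    [Im F] are [- Im F'] and [Re F'], and [holomorphic_cderiv] brings these back into the class. *)
Lemma smooth_partials (u : C -> R) :
  smooth D u ->
  (forall z, D z -> ex_derive (fun a => u (a, Im z)) (Re z) /\
                    ex_derive (fun b => u (Re z, b)) (Im z)) /\
  smooth D (pd_beta u).
Proof.
  induction 1 as [F HF | F HF | | c | u v Hu [IHu IHu'] Hv [IHv IHv']
                 | u v Hu [IHu IHu'] Hv [IHv IHv'] | u v E Hu [IHu IHu']].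
  - split.
    + intros z Hz; destruct (is_cderiv_partials F z _ (proj1 (HF z Hz))) as (A & _ & B & _).
      split; eexists; eassumption.
    + apply (smooth_ext D (fun z => -1 * Im (cderiv F z))).
      * intros z Hz; destruct (is_cderiv_partials F z _ (proj1 (HF z Hz))) as (_ & _ & B & _).
        etransitivity; [|symmetry; exact (is_derive_unique _ _ _ B)]; ring.
      * apply (smooth_mult D (fun _ => -1)); [apply smooth_const|].
        apply smooth_Im, holomorphic_cderiv; assumption.
  - split.
    + intros z Hz; destruct (is_cderiv_partials F z _ (proj1 (HF z Hz))) as (_ & A & _ & B).
      split; eexists; eassumption.
    + apply (smooth_ext D (fun z => Re (cderiv F z))).
      * intros z Hz; destruct (is_cderiv_partials F z _ (proj1 (HF z Hz))) as (_ & _ & _ & B).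
        etransitivity; [|symmetry; exact (is_derive_unique _ _ _ B)]; ring.
      * apply smooth_Re, holomorphic_cderiv; assumption.
  - split.
    + intros z Hz; split;
        [exact (ex_derive_const (K := R_AbsRing) (V := R_NormedModule) (/ Im z) _)|].
      simpl; auto_derive; apply D_nonreal, Hz.
    + apply (smooth_ext D (fun z => -1 * (/ Im z * / Im z))).
      * intros z Hz; pose proof (D_nonreal z Hz); symmetry; apply is_derive_unique; simpl.
        auto_derive; [assumption | field; assumption].
      * apply (smooth_mult D (fun _ => -1)); [apply smooth_const|].
        apply smooth_mult; apply smooth_inv_Im.
  - split.
    + intros z Hz; split; exact (ex_derive_const (K := R_AbsRing) (V := R_NormedModule) _ _).
    + apply (smooth_ext D (fun z => 0)); [|apply smooth_const].
      intros z Hz; symmetry; exact (Derive_const c (Im z)).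
  - split.
    + intros z Hz; destruct (IHu z Hz), (IHv z Hz); split.
      * apply (ex_derive_plus (V := R_NormedModule) (fun a => u (a, Im z))); assumption.
      * apply (ex_derive_plus (V := R_NormedModule) (fun b => u (Re z, b))); assumption.
    + apply (smooth_ext D (fun z => pd_beta u z + pd_beta v z)).
      * intros z Hz; destruct (IHu z Hz), (IHv z Hz); symmetry.
        apply (Derive_plus (fun b => u (Re z, b))); assumption.
      * apply smooth_plus; assumption.
  - split.
    + intros z Hz; destruct (IHu z Hz), (IHv z Hz); split.
      * apply (ex_derive_mult (fun a => u (a, Im z))); assumption.
      * apply (ex_derive_mult (fun b => u (Re z, b))); assumption.
    + apply (smooth_ext D (fun z => pd_beta u z * v z + u z * pd_beta v z)).
      * intros z Hz; destruct (IHu z Hz), (IHv z Hz); symmetry.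
        unfold pd_beta; rewrite (Derive_mult (fun b => u (Re z, b))) by assumption.
        destruct z; reflexivity.
      * apply smooth_plus; apply smooth_mult; assumption.
  - split.
    + intros z Hz; destruct (IHu z Hz) as [[l A] [m B]]; split; eexists.
      * apply (is_derive_alpha_ext u v z l E Hz A).
      * apply (is_derive_beta_ext u v z m E Hz B).
    + apply (smooth_ext D (pd_beta u)); [|assumption].
      intros z Hz; apply pd_beta_ext; assumption.
Qed.

Lemma smooth_is_derive_beta (u : C -> R) (z : C) :
  smooth D u -> D z -> is_derive (fun b => u (Re z, b)) (Im z) (pd_beta u z).
Proof. intros Hu Hz; apply Derive_correct, (smooth_partials u Hu), Hz. Qed.

Hypothesis D_sym : conj_invariant D.

(** Parity has to survive differentiation for [stem_dz] to produce a stem function again; [s] will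
    be 1 for the even and -1 for the odd component. *)
Lemma pd_alpha_parity (u : C -> R) (s : R) (z : C) :
  smooth D u -> (forall w, D w -> u (Cconj w) = s * u w) -> D z ->
  pd_alpha u (Cconj z) = s * pd_alpha u z.
Proof.
  intros Hu Hs Hz; unfold pd_alpha; simpl Re; simpl Im.
  rewrite <- Derive_scal; apply Derive_ext_loc.
  apply filter_imp with (2 := proj1 (locally_slices D z D_open Hz)); intros a Ha.
  apply (Hs (a, Im z)), Ha.
Qed.

Lemma pd_beta_parity (u : C -> R) (s : R) (z : C) :
  smooth D u -> (forall w, D w -> u (Cconj w) = s * u w) -> D z ->
  pd_beta u (Cconj z) = - s * pd_beta u z.
Proof.
  intros Hu Hs Hz; unfold pd_beta at 1; simpl Re; simpl Im.
  assert (Hz' : D (Cconj z)) by exact (proj1 (D_sym z) Hz).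
  rewrite (Derive_ext_loc _ (fun b => s * u (Re z, - b))).
  2: { apply filter_imp with (2 := proj2 (locally_slices D _ D_open Hz')); intros b Hb.
       change (D (Re z, b)) in Hb; apply D_sym in Hb; unfold Cconj in Hb; simpl in Hb.
       rewrite <- (Hs _ Hb); unfold Cconj; simpl; rewrite Ropp_involutive; reflexivity. }
  apply is_derive_unique.
  replace (- s * pd_beta u z) with (s * (-1 * pd_beta u z)) by ring.
  apply (is_derive_scal (fun b => u (Re z, - b)) (- Im z) s).
  apply (is_derive_comp (K := R_AbsRing) (V := R_NormedModule) (fun b => u (Re z, b)) Ropp).
  - rewrite Ropp_involutive; apply smooth_is_derive_beta; assumption.
  - auto_derive; [exact I | ring].
Qed.

(** * Quaternion-valued smooth functions and their derivations *)

Definition qsmooth (u : C -> quat) : Prop :=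
  smooth D (fun z => q0 (u z)) /\ smooth D (fun z => q1 (u z)) /\
  smooth D (fun z => q2 (u z)) /\ smooth D (fun z => q3 (u z)).

Lemma smooth_opp (u : C -> R) : smooth D u -> smooth D (fun z => - u z).
Proof.
  intros H; apply (smooth_ext D (fun z => -1 * u z)); [intros; ring|].
  apply (smooth_mult D (fun _ => -1)); [apply smooth_const | assumption].
Qed.

Lemma smooth_minus (u v : C -> R) :
  smooth D u -> smooth D v -> smooth D (fun z => u z - v z).
Proof. intros; apply (smooth_plus D u (fun z => - v z)); [|apply smooth_opp]; assumption. Qed.

Lemma qsmooth_ext (u v : C -> quat) :
  (forall z, D z -> u z = v z) -> qsmooth u -> qsmooth v.
Proof.
  intros E (H0 & H1 & H2 & H3); split; [|split; [|split]];
    [refine (smooth_ext D _ _ _ H0) | refine (smooth_ext D _ _ _ H1)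
    |refine (smooth_ext D _ _ _ H2) | refine (smooth_ext D _ _ _ H3)];
    intros z Hz; simpl; rewrite (E z Hz); reflexivity.
Qed.

Lemma qsmooth_const (c : quat) : qsmooth (fun _ => c).
Proof. repeat split; apply smooth_const. Qed.

Lemma qsmooth_plus (u v : C -> quat) :
  qsmooth u -> qsmooth v -> qsmooth (fun z => u z + v z)%Q.
Proof.
  intros (A0 & A1 & A2 & A3) (B0 & B1 & B2 & B3); repeat split; simpl;
    apply smooth_plus; assumption.
Qed.

Lemma qsmooth_mult (u v : C -> quat) :
  qsmooth u -> qsmooth v -> qsmooth (fun z => u z * v z)%Q.
Proof.
  intros (A0 & A1 & A2 & A3) (B0 & B1 & B2 & B3); repeat split; simpl;
    repeat first [apply smooth_minus | apply smooth_plus | apply smooth_mult]; assumption.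
Qed.

Lemma qsmooth_RtoQ (u : C -> R) : smooth D u -> qsmooth (fun z => RtoQ (u z)).
Proof. intros; repeat split; simpl; [assumption | apply smooth_const ..]. Qed.

Lemma qsmooth_d_beta (u : C -> quat) : qsmooth u -> qsmooth (d_beta u).
Proof.
  intros (A0 & A1 & A2 & A3).
  exact (conj (proj2 (smooth_partials _ A0)) (conj (proj2 (smooth_partials _ A1))
        (conj (proj2 (smooth_partials _ A2)) (proj2 (smooth_partials _ A3))))).
Qed.

(** Abstracts what [d_alpha], [d_beta] and [sc_real] share, so that products and binomial sums are
    expanded once for all three. The product rule keeps the order of the factors, and locality on
    [D] allows rewriting under [T]. *)
Record derivation (T : (C -> quat) -> C -> quat) : Prop := {
  derivation_ext : forall u v, (forall z, D z -> u z = v z) ->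
    forall z, D z -> T u z = T v z;
  derivation_const : forall c z, D z -> T (fun _ => c) z = RtoQ 0;
  derivation_plus : forall u v z, qsmooth u -> qsmooth v -> D z ->
    T (fun w => u w + v w)%Q z = (T u z + T v z)%Q;
  derivation_mult : forall u v z, qsmooth u -> qsmooth v -> D z ->
    T (fun w => u w * v w)%Q z = (T u z * v z + u z * T v z)%Q }.

Definition qderive (u : R -> quat) (t : R) : quat :=
  Quat (Derive (fun s => q0 (u s)) t) (Derive (fun s => q1 (u s)) t)
       (Derive (fun s => q2 (u s)) t) (Derive (fun s => q3 (u s)) t).

Definition ex_qderive (u : R -> quat) (t : R) : Prop :=
  ex_derive (fun s => q0 (u s)) t /\ ex_derive (fun s => q1 (u s)) t /\
  ex_derive (fun s => q2 (u s)) t /\ ex_derive (fun s => q3 (u s)) t.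

Lemma qderive_plus (u v : R -> quat) (t : R) :
  ex_qderive u t -> ex_qderive v t ->
  qderive (fun s => u s + v s)%Q t = (qderive u t + qderive v t)%Q.
Proof.
  intros (A0 & A1 & A2 & A3) (B0 & B1 & B2 & B3).
  apply quat_eq; simpl; apply Derive_plus; assumption.
Qed.

(** With the components given as eight separate real functions, [auto_derive] can treat the
    product. *)
Lemma Derive_qmult (f0 f1 f2 f3 g0 g1 g2 g3 : R -> R) (t : R) :
  ex_derive f0 t -> ex_derive f1 t -> ex_derive f2 t -> ex_derive f3 t ->
  ex_derive g0 t -> ex_derive g1 t -> ex_derive g2 t -> ex_derive g3 t ->
  let u := fun s => Quat (f0 s) (f1 s) (f2 s) (f3 s) in
  let v := fun s => Quat (g0 s) (g1 s) (g2 s) (g3 s) in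
  qderive (fun s => u s * v s)%Q t = (qderive u t * v t + u t * qderive v t)%Q.
Proof.
  intros; apply quat_eq; simpl; apply is_derive_unique; auto_derive; try tauto; ring.
Qed.

Lemma qderive_mult (u v : R -> quat) (t : R) :
  ex_qderive u t -> ex_qderive v t ->
  qderive (fun s => u s * v s)%Q t = (qderive u t * v t + u t * qderive v t)%Q.
Proof.
  intros (A0 & A1 & A2 & A3) (B0 & B1 & B2 & B3).
  pose proof (Derive_qmult _ _ _ _ _ _ _ _ t A0 A1 A2 A3 B0 B1 B2 B3) as H.
  cbv zeta in H; simpl in H.
  destruct (u t) as [a0 a1 a2 a3] eqn:Eu, (v t) as [b0 b1 b2 b3] eqn:Ev.
  exact H.
Qed.

Lemma qsmooth_ex_alpha (u : C -> quat) (z : C) :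
  qsmooth u -> D z -> ex_qderive (fun a => u (a, Im z)) (Re z).
Proof.
  intros (A0 & A1 & A2 & A3) Hz; split; [|split; [|split]];
    [apply (proj1 (smooth_partials _ A0) z Hz) | apply (proj1 (smooth_partials _ A1) z Hz)
    |apply (proj1 (smooth_partials _ A2) z Hz) | apply (proj1 (smooth_partials _ A3) z Hz)].
Qed.

Lemma qsmooth_ex_beta (u : C -> quat) (z : C) :
  qsmooth u -> D z -> ex_qderive (fun b => u (Re z, b)) (Im z).
Proof.
  intros (A0 & A1 & A2 & A3) Hz; split; [|split; [|split]];
    [apply (proj1 (smooth_partials _ A0) z Hz) | apply (proj1 (smooth_partials _ A1) z Hz)
    |apply (proj1 (smooth_partials _ A2) z Hz) | apply (proj1 (smooth_partials _ A3) z Hz)].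
Qed.

Lemma derivation_d_alpha : derivation d_alpha.
Proof.
  split.
  - intros u v E z Hz; apply quat_eq; simpl;
      [apply (pd_alpha_ext (fun w => q0 (u w)) (fun w => q0 (v w)))
      |apply (pd_alpha_ext (fun w => q1 (u w)) (fun w => q1 (v w)))
      |apply (pd_alpha_ext (fun w => q2 (u w)) (fun w => q2 (v w)))
      |apply (pd_alpha_ext (fun w => q3 (u w)) (fun w => q3 (v w)))];
      try assumption; intros w Hw; rewrite (E w Hw); reflexivity.
  - intros c z _; apply quat_eq; simpl; apply Derive_const.
  - intros u v z Hu Hv Hz.
    apply (qderive_plus (fun a => u (a, Im z)) (fun a => v (a, Im z)));
      apply qsmooth_ex_alpha; assumption.
  - intros u v z Hu Hv Hz; destruct z as [x y].
    apply (qderive_mult (fun a => u (a, y)) (fun a => v (a, y)));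
      apply (fun w Hw => qsmooth_ex_alpha w (x, y) Hw Hz); assumption.
Qed.

Lemma derivation_d_beta : derivation d_beta.
Proof.
  split.
  - intros u v E z Hz; apply quat_eq; simpl;
      [apply (pd_beta_ext (fun w => q0 (u w)) (fun w => q0 (v w)))
      |apply (pd_beta_ext (fun w => q1 (u w)) (fun w => q1 (v w)))
      |apply (pd_beta_ext (fun w => q2 (u w)) (fun w => q2 (v w)))
      |apply (pd_beta_ext (fun w => q3 (u w)) (fun w => q3 (v w)))];
      try assumption; intros w Hw; rewrite (E w Hw); reflexivity.
  - intros c z _; apply quat_eq; simpl; apply Derive_const.
  - intros u v z Hu Hv Hz.
    apply (qderive_plus (fun b => u (Re z, b)) (fun b => v (Re z, b)));
      apply qsmooth_ex_beta; assumption.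
  - intros u v z Hu Hv Hz; destruct z as [x y].
    apply (qderive_mult (fun b => u (x, b)) (fun b => v (x, b)));
      apply (fun w Hw => qsmooth_ex_beta w (x, y) Hw Hz); assumption.
Qed.

(* [∂s ∂c] on the stem [(u, 0)]. *)
Definition sc_real (u : C -> quat) (z : C) : quat :=
  (RtoQ (- / 2 * / Im z) * d_beta u z)%Q.

Lemma derivation_sc_real : derivation sc_real.
Proof.
  destruct derivation_d_beta as [E Z P M]; unfold sc_real; split.
  - intros u v H z Hz; rewrite (E u v H z Hz); reflexivity.
  - intros c z Hz; rewrite (Z c z Hz); quat_ring.
  - intros u v z Hu Hv Hz; rewrite (P u v z Hu Hv Hz); quat_ring.
  - intros u v z Hu Hv Hz; rewrite (M u v z Hu Hv Hz); quat_ring.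
Qed.

Lemma qsmooth_sc_real (u : C -> quat) : qsmooth u -> qsmooth (sc_real u).
Proof.
  intros Hu; apply (qsmooth_mult (fun z => RtoQ (- / 2 * / Im z)));
    [|apply qsmooth_d_beta; assumption].
  apply qsmooth_RtoQ, (smooth_mult D (fun _ => - / 2));
    [apply smooth_const | apply smooth_inv_Im].
Qed.

Lemma qsmooth_sc_real_iter (n : nat) (u : C -> quat) :
  qsmooth u -> qsmooth (Nat.iter n sc_real u).
Proof.
  intros Hu; induction n as [|n IH]; [exact Hu | apply qsmooth_sc_real, IH].
Qed.

Lemma derivation_scal (T : (C -> quat) -> C -> quat) (c : quat) (u : C -> quat) (z : C) :
  derivation T -> qsmooth u -> D z -> T (fun w => c * u w)%Q z = (c * T u z)%Q.
Proof.
  intros [E Z P M] Hu Hz; rewrite (M (fun _ => c) u z (qsmooth_const c) Hu Hz), Z by assumption.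
  quat_ring.
Qed.

Lemma qsmooth_sum (u : nat -> C -> quat) (n : nat) :
  (forall i, qsmooth (u i)) -> qsmooth (fun w => sum_n_m (fun i => u i w) 0 n).
Proof.
  intros Hu; induction n as [|n IH].
  - apply (qsmooth_ext (u 0%nat)); [|apply Hu].
    intros z _; rewrite sum_n_n; reflexivity.
  - apply (qsmooth_ext (fun z => sum_n_m (fun i => u i z) 0 n + u (S n) z)%Q).
    + intros z _; rewrite sum_n_Sm by lia; reflexivity.
    + apply (qsmooth_plus (fun z => sum_n_m (fun i => u i z) 0 n)); [exact IH | apply Hu].
Qed.

Lemma derivation_sum (T : (C -> quat) -> C -> quat) (u : nat -> C -> quat) (n : nat) (z : C) :
  derivation T -> (forall i, qsmooth (u i)) -> D z ->
  T (fun w => sum_n_m (fun i => u i w) 0 n) z = sum_n_m (fun i => T (u i) z) 0 n.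
Proof.
  intros HT Hu Hz; pose proof HT as [E Z P M]; induction n as [|n IH].
  - rewrite sum_n_n; apply E; [|assumption]; intros w _; rewrite sum_n_n; reflexivity.
  - rewrite (sum_n_Sm (fun i => T (u i) z)) by lia; rewrite <- IH.
    transitivity (T (fun w => sum_n_m (fun i => u i w) 0 n + u (S n) w)%Q z).
    + apply E; [|assumption]; intros w _; rewrite sum_n_Sm by lia; reflexivity.
    + apply (P (fun w => sum_n_m (fun i => u i w) 0 n) (u (S n)) z);
        [apply qsmooth_sum; assumption | apply Hu | assumption].
Qed.

(** * Binomial sums and the iterated Leibniz rule *)

Lemma C_n_0 (n : nat) : Binomial.C n 0 = 1.
Proof.
  unfold Binomial.C; rewrite Nat.sub_0_r; simpl; field; apply INR_fact_neq_0.
Qed.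

Lemma C_n_n (n : nat) : Binomial.C n n = 1.
Proof.
  unfold Binomial.C; rewrite Nat.sub_diag; simpl; field; apply INR_fact_neq_0.
Qed.

Lemma sum_pascal (e : nat -> quat) (n : nat) :
  plus (sum_n_m (fun h => RtoQ (Binomial.C n h) * e (S h))%Q 0 n)
       (sum_n_m (fun h => RtoQ (Binomial.C n h) * e h)%Q 0 n) =
  sum_n_m (fun h => RtoQ (Binomial.C (S n) h) * e h)%Q 0 (S n).
Proof.
  (* Induction on the upper limit with the row [n] fixed. The extra term is the end of the shifted
     sum, not yet absorbed by Pascal's rule; at [m = n] it becomes the last term of row [S n], both
     coefficients being 1. *)
  assert (G : forall m, (m <= n)%nat ->
    plus (sum_n_m (fun h => RtoQ (Binomial.C n h) * e (S h))%Q 0 m)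
         (sum_n_m (fun h => RtoQ (Binomial.C n h) * e h)%Q 0 m) =
    plus (sum_n_m (fun h => RtoQ (Binomial.C (S n) h) * e h)%Q 0 m)
         (RtoQ (Binomial.C n m) * e (S m))%Q).
  { induction m as [|m IH]; intros Hm.
    - rewrite !sum_n_n, !C_n_0; apply Qplus_comm.
    - rewrite !(sum_n_Sm _ 0 m) by lia.
      rewrite <- (pascal n m) by lia.
      specialize (IH ltac:(lia)).
      set (X := sum_n_m (fun h => RtoQ (Binomial.C n h) * e (S h))%Q 0 m) in *.
      set (Y := sum_n_m (fun h => RtoQ (Binomial.C n h) * e h)%Q 0 m) in *.
      set (W := sum_n_m (fun h => RtoQ (Binomial.C (S n) h) * e h)%Q 0 m) in *.
      unfold plus in *; simpl in *.
      transitivity ((X + Y) + RtoQ (Binomial.C n (S m)) * e (S (S m))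
                    + RtoQ (Binomial.C n (S m)) * e (S m))%Q; [quat_ring|].
      rewrite IH; quat_ring. }
  rewrite G by lia; rewrite (sum_n_Sm _ 0 n) by lia.
  rewrite !C_n_n; reflexivity.
Qed.

Lemma sum_n_m_plus_quat (a b : nat -> quat) (n m : nat) :
  sum_n_m (fun i => a i + b i)%Q n m = (sum_n_m a n m + sum_n_m b n m)%Q.
Proof. apply (sum_n_m_plus (G := quat_AbelianMonoid)). Qed.

(** Only the recursion on [e] is used, not a product structure: a sum of two noncommutative products
    with opposite orders of the factors can then be expanded in one sum. *)
Lemma sc_real_iter_leibniz (e : nat -> nat -> C -> quat) (n : nat) (z : C) :
  (forall i j, qsmooth (e i j)) ->
  (forall i j w, D w -> sc_real (e i j) w = (e (S i) j w + e i (S j) w)%Q) ->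
  D z ->
  Nat.iter n sc_real (e 0%nat 0%nat) z =
  sum_n_m (fun h => RtoQ (Binomial.C n h) * e h (n - h)%nat z)%Q 0 n.
Proof.
  intros He HL; revert z; induction n as [|n IH]; intros z Hz.
  - rewrite sum_n_n, C_n_0; simpl; quat_ring.
  - simpl Nat.iter.
    rewrite (derivation_ext _ derivation_sc_real _ _ IH z Hz).
    rewrite (derivation_sum sc_real (fun h w => RtoQ (Binomial.C n h) * e h (n - h)%nat w)%Q);
      [|apply derivation_sc_real | |assumption].
    2: { intros i; apply (qsmooth_mult (fun _ => RtoQ (Binomial.C n i)));
         [apply qsmooth_const | apply He]. }
    rewrite <- sum_pascal.
    rewrite <- (sum_n_m_plus (G := quat_AbelianMonoid)).
    apply sum_n_m_ext_loc; intros h Hh.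
    rewrite (derivation_scal sc_real) by (auto using derivation_sc_real).
    rewrite HL by assumption.
    replace (S n - S h)%nat with (n - h)%nat by lia.
    replace (S n - h)%nat with (S (n - h)) by lia.
    unfold plus; simpl; quat_ring.
Qed.

(** * Parity under complex conjugation *)

Definition qparity (s : R) (u : C -> quat) : Prop :=
  forall z, D z -> u (Cconj z) = (RtoQ s * u z)%Q.

Lemma qparity_components (s : R) (u : C -> quat) :
  qparity s u -> forall z, D z ->
  q0 (u (Cconj z)) = s * q0 (u z) /\ q1 (u (Cconj z)) = s * q1 (u z) /\
  q2 (u (Cconj z)) = s * q2 (u z) /\ q3 (u (Cconj z)) = s * q3 (u z).
Proof. intros H z Hz; rewrite (H z Hz); repeat split; simpl; ring. Qed.

Lemma qparity_d_alpha (s : R) (u : C -> quat) :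
  qsmooth u -> qparity s u -> qparity s (d_alpha u).
Proof.
  intros (A0 & A1 & A2 & A3) H z Hz.
  pose proof (pd_alpha_parity _ s z A0 (fun w Hw => proj1 (qparity_components s u H w Hw)) Hz).
  pose proof (pd_alpha_parity _ s z A1
    (fun w Hw => proj1 (proj2 (qparity_components s u H w Hw))) Hz).
  pose proof (pd_alpha_parity _ s z A2
    (fun w Hw => proj1 (proj2 (proj2 (qparity_components s u H w Hw)))) Hz).
  pose proof (pd_alpha_parity _ s z A3
    (fun w Hw => proj2 (proj2 (proj2 (qparity_components s u H w Hw)))) Hz).
  apply quat_eq; simpl; rewrite ?Rmult_0_l, ?Rminus_0_r, ?Rplus_0_r;
    (etransitivity; [eassumption|]); unfold pd_alpha; ring.
Qed.

Lemma qparity_d_beta (s : R) (u : C -> quat) :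
  qsmooth u -> qparity s u -> qparity (- s) (d_beta u).
Proof.
  intros (A0 & A1 & A2 & A3) H z Hz.
  pose proof (pd_beta_parity _ s z A0 (fun w Hw => proj1 (qparity_components s u H w Hw)) Hz).
  pose proof (pd_beta_parity _ s z A1
    (fun w Hw => proj1 (proj2 (qparity_components s u H w Hw))) Hz).
  pose proof (pd_beta_parity _ s z A2
    (fun w Hw => proj1 (proj2 (proj2 (qparity_components s u H w Hw)))) Hz).
  pose proof (pd_beta_parity _ s z A3
    (fun w Hw => proj2 (proj2 (proj2 (qparity_components s u H w Hw)))) Hz).
  apply quat_eq; simpl; rewrite ?Rmult_0_l, ?Rminus_0_r, ?Rplus_0_r;
    (etransitivity; [eassumption|]); unfold pd_beta; ring.
Qed.

End Smooth.

Local Open Scope quat_scope.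

(** * Stem functions of the iterated operators *)

Lemma RtoQ_mult (c : R) (x : quat) :
  RtoQ c * x = Quat (c * q0 x) (c * q1 x) (c * q2 x) (c * q3 x).
Proof. quat_ring. Qed.

Section Stems.
Variable D : C -> Prop.
Hypothesis D_open : open D.
Hypothesis D_nonreal : forall z, D z -> Im z <> 0%R.
Hypothesis D_sym : conj_invariant D.

(** The operators act on total functions, but equality is asked on the circularization only; this
    relation carries every computation from slice functions to stems. *)
Definition has_stem (f : quat -> quat) (F : C -> quat * quat) : Prop :=
  stem_fun D F /\ forall x, circularization D x -> f x = induced F x.

Lemma has_stem_eval f F alpha beta I :
  has_stem f F -> D (alpha, beta) -> in_S I ->
  f (RtoQ alpha + I * RtoQ beta) =
  fst (F (alpha, beta)) + I * snd (F (alpha, beta)).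
Proof.
  intros [HF Hf] Hz HI; rewrite Hf by (apply circularization_intro; assumption).
  apply (induced_spec D); assumption.
Qed.

Lemma has_stem_intro f F :
  stem_fun D F ->
  (forall alpha beta I, D (alpha, beta) -> in_S I ->
     f (RtoQ alpha + I * RtoQ beta) =
     fst (F (alpha, beta)) + I * snd (F (alpha, beta))) ->
  has_stem f F.
Proof.
  intros HF H; split; [assumption|]; intros x (alpha & beta & I & Hz & HI & ->).
  rewrite H by assumption; symmetry; apply (induced_spec D); assumption.
Qed.

Lemma stem_fun_qparity F :
  stem_fun D F <-> qparity D 1 (fun z => fst (F z)) /\ qparity D (-1) (fun z => snd (F z)).
Proof.
  split.
  - intros H; split; intros z Hz; destruct (H z Hz) as [E0 E1]; simpl;
      [rewrite E0 | rewrite E1]; quat_ring.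
  - intros [H0 H1] z Hz; rewrite (H0 z Hz), (H1 z Hz); split; quat_ring.
Qed.

Lemma stem_fun_ext F G :
  (forall z, D z -> F z = G z) -> stem_fun D F -> stem_fun D G.
Proof.
  intros E H z Hz; rewrite <- (E z Hz), <- (E (Cconj z) (proj1 (D_sym z) Hz)).
  apply H, Hz.
Qed.

Lemma has_stem_ext f F G :
  (forall z, D z -> F z = G z) -> has_stem f F -> has_stem f G.
Proof.
  intros E [HF Hf]; apply has_stem_intro.
  - exact (stem_fun_ext F G E HF).
  - intros alpha beta I Hz HI; rewrite <- (E _ Hz).
    apply has_stem_eval; [split|..]; assumption.
Qed.

Lemma has_stem_stem_of f F z : has_stem f F -> D z -> stem_of f z = F z.
Proof. intros [HF Hf] Hz; apply (stem_of_spec D); assumption. Qed.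

Lemma stem_fun_mult F G : stem_fun D F -> stem_fun D G -> stem_fun D (stem_mult F G).
Proof.
  intros HF HG z Hz; destruct (HF z Hz) as [F0 F1], (HG z Hz) as [G0 G1].
  unfold stem_mult; simpl; rewrite F0, F1, G0, G1; split; quat_ring.
Qed.

Lemma has_stem_mult f g F G :
  has_stem f F -> has_stem g G -> has_stem (f ⋅ g) (stem_mult F G).
Proof.
  intros Hf Hg.
  assert (E : forall z, D z ->
    stem_mult F G z = stem_mult (stem_of f) (stem_of g) z).
  { intros z Hz; unfold stem_mult.
    rewrite (has_stem_stem_of f F z Hf Hz), (has_stem_stem_of g G z Hg Hz); reflexivity. }
  apply has_stem_ext with (stem_mult (stem_of f) (stem_of g)).
  { intros z Hz; symmetry; apply E, Hz. }
  split; [|reflexivity].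
  apply (stem_fun_ext _ _ E), stem_fun_mult; [apply Hf | apply Hg].
Qed.

Lemma has_stem_spherical_value f F :
  has_stem f F -> has_stem (v_s f) (fun z => (fst (F z), RtoQ 0)).
Proof.
  intros [HF Hf]; apply has_stem_intro.
  - intros z Hz; destruct (HF z Hz) as [E _]; simpl; rewrite E; split; quat_ring.
  - intros alpha beta I Hz HI; simpl.
    rewrite (spherical_value_spec D F) by assumption; quat_ring.
Qed.

(** [F1] and [Im z] are both odd under conjugation, so their quotient is even and can stand alone as
    a first component. *)
Lemma has_stem_spherical_derivative f F :
  has_stem f F -> has_stem (∂s f) (fun z => (RtoQ (/ Im z) * snd (F z), RtoQ 0)).
Proof.
  intros [HF Hf]; apply has_stem_intro.
  - intros z Hz; destruct (HF z Hz) as [_ E]; simpl; rewrite E.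
    pose proof (D_nonreal z Hz); destruct z as [x y]; simpl in *.
    split; quat_ring; field; assumption.
  - intros alpha beta I Hz HI; simpl.
    rewrite (spherical_derivative_spec D F) by
      first [assumption | exact (D_nonreal (alpha, beta) Hz)]; quat_ring.
Qed.

Lemma stem_fun_dz F :
  qsmooth D (fun z => fst (F z)) -> qsmooth D (fun z => snd (F z)) ->
  stem_fun D F -> stem_fun D (stem_dz F).
Proof.
  intros S0 S1 HF; apply stem_fun_qparity in HF; destruct HF as [P0 P1].
  intros z Hz; unfold stem_dz; simpl.
  pose proof (qparity_d_alpha D D_open 1 _ S0 P0 z Hz) as A0.
  pose proof (qparity_d_alpha D D_open (-1) _ S1 P1 z Hz) as A1.
  pose proof (qparity_d_beta D D_open D_nonreal D_sym 1 _ S0 P0 z Hz) as B0.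
  pose proof (qparity_d_beta D D_open D_nonreal D_sym (-1) _ S1 P1 z Hz) as B1.
  rewrite A0, A1, B0, B1; split; quat_ring.
Qed.

Lemma has_stem_slice_derivative f F :
  qsmooth D (fun z => fst (F z)) -> qsmooth D (fun z => snd (F z)) ->
  has_stem f F -> has_stem (∂c f) (stem_dz F).
Proof.
  intros S0 S1 [HF Hf].
  assert (E : forall z, D z -> stem_dz F z = stem_dz (stem_of f) z)
    by (intros z Hz; symmetry; apply (stem_dz_spec D); assumption).
  apply has_stem_ext with (stem_dz (stem_of f)).
  { intros z Hz; symmetry; apply E, Hz. }
  split; [|reflexivity].
  apply (stem_fun_ext _ _ E), stem_fun_dz; assumption.
Qed.

(** Real with respect to the complexification: the values are still quaternions, and the induced
    function is constant on each sphere. *)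
Definition real_stem (u : C -> quat) (z : C) : quat * quat := (u z, RtoQ 0).

Definition dz_real (u : C -> quat) (z : C) : quat * quat :=
  (RtoQ (1 / 2) * d_alpha u z, - (RtoQ (1 / 2) * d_beta u z)).

Lemma stem_dz_real_stem u z : stem_dz (real_stem u) z = dz_real u z.
Proof.
  unfold stem_dz, dz_real, real_stem; simpl.
  change (fun w : C => u w) with u.
  replace (d_alpha (fun _ => RtoQ 0) z) with (RtoQ 0)
    by (apply quat_eq; symmetry; simpl; apply Derive_const).
  replace (d_beta (fun _ => RtoQ 0) z) with (RtoQ 0)
    by (apply quat_eq; symmetry; simpl; apply Derive_const).
  f_equal; quat_ring.
Qed.

Lemma eval_mult_dz_real_l u v z (J : quat) :
  fst (stem_mult (dz_real u) (real_stem v) z) + J * snd (stem_mult (dz_real u) (real_stem v) z) =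
  RtoQ (1 / 2) * (d_alpha u z * v z - J * (d_beta u z * v z)).
Proof.
  unfold stem_mult, dz_real, real_stem; simpl fst; simpl snd.
  generalize (d_alpha u z) (d_beta u z) (v z) (1 / 2)%R; intros; rewrite !RtoQ_mult; quat_ring.
Qed.

(** In the slice product the imaginary unit stays to the left of [u], which a pointwise product
    would not do. Both orders of factors thus have [J] outermost, and their terms can be added. *)
Lemma eval_mult_dz_real_r u v z (J : quat) :
  fst (stem_mult (real_stem u) (dz_real v) z) + J * snd (stem_mult (real_stem u) (dz_real v) z) =
  RtoQ (1 / 2) * (u z * d_alpha v z - J * (u z * d_beta v z)).
Proof.
  unfold stem_mult, dz_real, real_stem; simpl fst; simpl snd.
  generalize (d_alpha v z) (d_beta v z) (u z) (1 / 2)%R; intros; rewrite !RtoQ_mult; quat_ring.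
Qed.

Lemma has_stem_slice_derivative_real f u :
  qsmooth D u -> has_stem f (real_stem u) -> has_stem (∂c f) (dz_real u).
Proof.
  intros Hu Hf; apply has_stem_ext with (stem_dz (real_stem u)).
  - intros z _; apply stem_dz_real_stem.
  - apply has_stem_slice_derivative; [exact Hu | exact (qsmooth_const D (RtoQ 0)) | exact Hf].
Qed.

Lemma has_stem_spherical_dz_real f u :
  has_stem f (dz_real u) -> has_stem (∂s f) (real_stem (sc_real u)).
Proof.
  intros Hf; apply has_stem_spherical_derivative in Hf.
  apply has_stem_ext with (2 := Hf); intros z Hz; unfold real_stem, sc_real; simpl.
  f_equal; quat_ring; field; exact (D_nonreal z Hz).
Qed.

Lemma has_stem_cs f u n :
  qsmooth D u -> has_stem (∂s f) (real_stem u) ->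
  has_stem (∂s (cs_pow n f)) (real_stem (Nat.iter n sc_real u)).
Proof.
  intros Hu Hf; induction n as [|n IH]; [exact Hf|].
  apply has_stem_spherical_dz_real.
  apply (has_stem_slice_derivative_real (∂s (cs_pow n f))); [|exact IH].
  apply qsmooth_sc_real_iter; assumption.
Qed.

Lemma has_stem_cs_S f u n :
  qsmooth D u -> has_stem (∂s f) (real_stem u) ->
  has_stem (cs_pow (S n) f) (dz_real (Nat.iter n sc_real u)).
Proof.
  intros Hu Hf; apply (has_stem_slice_derivative_real (∂s (cs_pow n f))).
  - apply qsmooth_sc_real_iter; assumption.
  - apply has_stem_cs; assumption.
Qed.

(** The assumption bears on [∂c f] because [f] itself has in general no real stem; the composition
    starts with [∂c] anyway. *)
Lemma has_stem_sc f u n :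
  qsmooth D u -> has_stem (∂c f) (dz_real u) ->
  has_stem (∂c (sc_pow n f)) (dz_real (Nat.iter n sc_real u)).
Proof.
  intros Hu Hf; induction n as [|n IH]; [exact Hf|].
  apply (has_stem_slice_derivative_real (∂s (∂c (sc_pow n f)))).
  - apply qsmooth_sc_real_iter with (n := S n); assumption.
  - apply has_stem_spherical_dz_real, IH.
Qed.

Lemma has_stem_sc_S f u n :
  qsmooth D u -> has_stem (∂c f) (dz_real u) ->
  has_stem (sc_pow (S n) f) (real_stem (Nat.iter (S n) sc_real u)).
Proof.
  intros Hu Hf; apply (has_stem_spherical_dz_real (∂c (sc_pow n f))).
  apply has_stem_sc; assumption.
Qed.

(** The stem equations hold component by component, so [qc F0 + i qc F1] is a complex holomorphic
    function. The hypotheses on [qc] hold by computation for each of the four coordinates. *)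
Lemma holomorphic_component (qc : quat -> R) (F : C -> quat * quat) :
  (forall z, D z -> qc (d_alpha (fun w => fst (F w)) z) = pd_alpha (fun w => qc (fst (F w))) z) ->
  (forall z, D z -> qc (d_alpha (fun w => snd (F w)) z) = pd_alpha (fun w => qc (snd (F w))) z) ->
  (forall z, D z -> qc (d_beta (fun w => fst (F w)) z) = pd_beta (fun w => qc (fst (F w))) z) ->
  (forall z, D z -> qc (d_beta (fun w => snd (F w)) z) = pd_beta (fun w => qc (snd (F w))) z) ->
  (forall x, qc (- x) = (- qc x)%R) ->
  C1_real D (fun z => qc (fst (F z))) -> C1_real D (fun z => qc (snd (F z))) ->
  (forall z, D z -> d_alpha (fun w => fst (F w)) z = d_beta (fun w => snd (F w)) z /\
                    d_beta (fun w => fst (F w)) z = - d_alpha (fun w => snd (F w)) z) ->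
  smooth D (fun z => qc (fst (F z))) /\ smooth D (fun z => qc (snd (F z))).
Proof.
  intros Ea0 Ea1 Eb0 Eb1 Eo C0 C1 CR.
  set (u := fun z => qc (fst (F z))) in *; set (v := fun z => qc (snd (F z))) in *.
  assert (H : holomorphic D (fun z => (u z, v z))).
  { intros z Hz.
    assert (E : is_cderiv (fun z => (u z, v z)) z (pd_alpha u z, pd_alpha v z)).
    { apply (is_cderiv_CR u v (pd_alpha u) (pd_beta u) (pd_alpha v) (pd_beta v) D z
               D_open Hz).
      - intros w Hw; apply Derive_correct, (C0 w Hw).
      - intros w Hw; apply Derive_correct, (C0 w Hw).
      - intros w Hw; apply Derive_correct, (C1 w Hw).
      - intros w Hw; apply Derive_correct, (C1 w Hw).
      - apply (C0 z Hz).
      - apply (C1 z Hz).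
      - rewrite <- Ea0, <- Eb1 by assumption; f_equal; apply CR, Hz.
      - rewrite <- Eb0, <- Ea1, <- Eo by assumption; f_equal; apply CR, Hz. }
    split.
    - rewrite (is_cderiv_unique _ _ _ E); exact E.
    - apply continuous_C; [apply (C0 z Hz) | apply (C1 z Hz)]. }
  split; [exact (smooth_Re D _ H) | exact (smooth_Im D _ H)].
Qed.

Lemma holomorphic_stem_qsmooth F :
  holomorphic_stem D F ->
  qsmooth D (fun z => fst (F z)) /\ qsmooth D (fun z => snd (F z)).
Proof.
  intros ((A0 & A1 & A2 & A3) & (B0 & B1 & B2 & B3) & CR).
  destruct (holomorphic_component q0 F) as [S0 T0]; try assumption; try reflexivity.
  destruct (holomorphic_component q1 F) as [S1 T1]; try assumption; try reflexivity.
  destruct (holomorphic_component q2 F) as [S2 T2]; try assumption; try reflexivity.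
  destruct (holomorphic_component q3 F) as [S3 T3]; try assumption; try reflexivity.
  split; repeat split; assumption.
Qed.

(* [dF/dz = 2 d(F0)/dz] because [F + conj F = 2 F0] and [conj F] is antiholomorphic. *)
Lemma holomorphic_stem_data f F :
  has_stem f F -> holomorphic_stem D F ->
  let a := fun z => RtoQ 2 * fst (F z) in
  let p := fun z => RtoQ (/ Im z) * snd (F z) in
  qsmooth D a /\ qsmooth D p /\ has_stem (v_s f) (real_stem (fun z => RtoQ (1 / 2) * a z)) /\
  has_stem (∂s f) (real_stem p) /\ has_stem (∂c f) (dz_real a).
Proof.
  intros Hf HF a p; destruct (holomorphic_stem_qsmooth F HF) as [S0 S1].
  repeat match goal with |- _ /\ _ => split end.
  - apply (qsmooth_mult D (fun _ => RtoQ 2)); [apply qsmooth_const | exact S0].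
  - apply (qsmooth_mult D (fun z => RtoQ (/ Im z))); [|exact S1].
    apply qsmooth_RtoQ, smooth_inv_Im.
  - apply has_stem_ext with (2 := has_stem_spherical_value f F Hf).
    intros z _; unfold real_stem, a; f_equal; quat_ring.
  - exact (has_stem_spherical_derivative f F Hf).
  - apply has_stem_ext with (2 := has_stem_slice_derivative f F S0 S1 Hf).
    intros z Hz; destruct HF as (_ & _ & CR); destruct (CR z Hz) as [E0 E1].
    unfold stem_dz, dz_real, a.
    rewrite (derivation_scal D d_alpha) by auto using derivation_d_alpha.
    rewrite (derivation_scal D d_beta) by auto using derivation_d_beta.
    rewrite <- E0, E1; f_equal; quat_ring.
Qed.

(** Here [n] is [k - 1], so that the truncated subtractions of the statement become [n - h] and
    [S (n - h)]. *)
Theorem cs_pow_mult f g F G n x :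
  has_stem f F -> holomorphic_stem D F -> has_stem g G -> holomorphic_stem D G ->
  circularization D x ->
  cs_pow (S n) (f ⋅ g) x =
    (cs_pow (S n) f ⋅ v_s g) x + (v_s f ⋅ cs_pow (S n) g) x
    + RtoQ (1 / 2) *
      (sum_n_m (fun h : nat =>
         RtoQ (Binomial.C n h) *
         ((∂s (cs_pow (n - h) f) ⋅ ∂c (sc_pow h g)) x
          + (∂c (sc_pow h f) ⋅ ∂s (cs_pow (n - h) g)) x)) 0 n
       + sum_n_m (fun h : nat =>
         RtoQ (Binomial.C n h) *
         ((cs_pow (S (n - h)) f ⋅ sc_pow h g) x
          + (sc_pow h f ⋅ cs_pow (S (n - h)) g) x)) 1 n).
Proof.
  intros Hf HF Hg HG (alpha & beta & J & Hz & HJ & ->).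
  destruct (holomorphic_stem_data f F Hf HF) as (Sa & Sp & Vf & Pf & Cf).
  destruct (holomorphic_stem_data g G Hg HG) as (Sb & Sr & Vg & Pg & Cg).
  set (a := fun z => RtoQ 2 * fst (F z)) in *; set (p := fun z => RtoQ (/ Im z) * snd (F z)) in *.
  set (b := fun z => RtoQ 2 * fst (G z)) in *; set (r := fun z => RtoQ (/ Im z) * snd (G z)) in *.
  change (has_stem (v_s f) (real_stem (fun z => RtoQ (1 / 2) * a z))) in Vf.
  change (has_stem (v_s g) (real_stem (fun z => RtoQ (1 / 2) * b z))) in Vg.
  set (L := fun n u => Nat.iter n sc_real u).
  assert (SL : forall i u, qsmooth D u -> qsmooth D (L i u))
    by (intros; apply qsmooth_sc_real_iter; assumption).
  (* [r] is the function called [q] in the overview. The index [i] goes with [a] and [b], the index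
     [j] with [p] and [r], whichever side they stand on. *)
  set (e := fun i j z => RtoQ (1 / 2) * (L i a z * L j r z + L j p z * L i b z)).
  (* Serves three times: [sc_real] gives the recursion for [e], while [d_alpha] and [d_beta] give
     the outermost [∂c]. *)
  assert (De : forall T, derivation D T -> forall i j z, D z -> T (e i j) z =
    RtoQ (1 / 2) * (T (L i a) z * L j r z + L i a z * T (L j r) z +
      (T (L j p) z * L i b z + L j p z * T (L i b) z))).
  { intros T HT i j z Hz'; unfold e.
    assert (S1 : qsmooth D (fun z => L i a z * L j r z)) by (apply qsmooth_mult; auto).
    assert (S2 : qsmooth D (fun z => L j p z * L i b z)) by (apply qsmooth_mult; auto).
    rewrite (derivation_scal D T _ (fun z => L i a z * L j r z + L j p z * L i b z))
      by (auto using qsmooth_plus).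
    rewrite (derivation_plus D T HT (fun z => L i a z * L j r z)) by assumption.
    rewrite !(derivation_mult D T HT) by auto; reflexivity. }
  assert (Se : forall i j, qsmooth D (e i j)).
  { intros i j; apply (qsmooth_mult D (fun _ => RtoQ (1 / 2))); [apply qsmooth_const|].
    apply qsmooth_plus; apply qsmooth_mult; auto. }
  assert (Hsh : derivation D sc_real) by (apply derivation_sc_real; assumption).
  assert (Hfg : has_stem (∂s (f ⋅ g)) (real_stem (e 0%nat 0%nat))).
  { apply has_stem_ext with
      (2 := has_stem_spherical_derivative _ _ (has_stem_mult f g F G Hf Hg)).
    intros z Hz'; unfold real_stem, stem_mult, e, L, a, b, p, r; simpl; f_equal; quat_ring;
    field; exact (D_nonreal z Hz'). }
  pose proof (has_stem_cs_S (f ⋅ g) _ n (Se 0%nat 0%nat) Hfg) as Hcs.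
  assert (EL : forall z, D z -> Nat.iter n sc_real (e 0%nat 0%nat) z =
    sum_n_m (fun h => RtoQ (Binomial.C n h) * e h (n - h)%nat z) 0 n).
  { intros z; apply (sc_real_iter_leibniz D); try assumption.
    intros i j w Hw; rewrite (De sc_real) by assumption; unfold e.
    change (L (S i) a) with (sc_real (L i a)); change (L (S i) b) with (sc_real (L i b)).
    change (L (S j) r) with (sc_real (L j r)); change (L (S j) p) with (sc_real (L j p)).
    generalize (L i a w) (L i b w) (L j p w) (L j r w) (sc_real (L i a) w) (sc_real (L i b) w)
      (sc_real (L j p) w) (sc_real (L j r) w) (1 / 2)%R; quat_ring. }
  assert (ET : forall T, derivation D T -> forall z, D z ->
    T (Nat.iter n sc_real (e 0%nat 0%nat)) z =
    sum_n_m (fun h => RtoQ (Binomial.C n h) * T (e h (n - h)%nat) z) 0 n).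
  { intros T HT z Hz'; rewrite (derivation_ext D T HT _ _ EL z Hz').
    rewrite (derivation_sum D T (fun h w => RtoQ (Binomial.C n h) * e h (n - h)%nat w));
      [|assumption | |assumption].
    - apply sum_n_m_ext; intros h; apply (derivation_scal D T); auto.
    - intros h; apply (qsmooth_mult D (fun _ => RtoQ (Binomial.C n h)));
        [apply qsmooth_const | apply Se]. }
  assert (Ev : forall f g F G, has_stem f F -> has_stem g G ->
    (f ⋅ g) (RtoQ alpha + J * RtoQ beta) =
    fst (stem_mult F G (alpha, beta)) + J * snd (stem_mult F G (alpha, beta))).
  { intros f1 g1 F1 G1 H1 H2; apply has_stem_eval; [apply has_stem_mult|..]; assumption. }
  assert (HA : derivation D d_alpha) by (apply derivation_d_alpha; assumption).
  assert (HB : derivation D d_beta) by (apply derivation_d_beta; assumption).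
  set (z := (alpha, beta) : C) in *.
  set (W1 := fun h => 
     (∂s (cs_pow (n - h) f) ⋅ ∂c (sc_pow h g)) (RtoQ alpha + J * RtoQ beta)
     + (∂c (sc_pow h f) ⋅ ∂s (cs_pow (n - h) g)) (RtoQ alpha + J * RtoQ beta)).
  set (W2 := fun h => 
     (cs_pow (S (n - h)) f ⋅ sc_pow h g) (RtoQ alpha + J * RtoQ beta)
     + (sc_pow h f ⋅ cs_pow (S (n - h)) g) (RtoQ alpha + J * RtoQ beta)).
  (* The value of [W2 h] computed with the stems [L h a] and [L h b] also at [h = 0], where
     [sc_pow 0 f] is [f] and has another stem; [EW2] is accordingly restricted to successors. *)
  set (V2 := fun h =>
     RtoQ (1 / 2) * (d_alpha (L (n - h)%nat p) z * L h b z - J * (d_beta (L (n - h)%nat p) z * L h b z))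
     + RtoQ (1 / 2) * (L h a z * d_alpha (L (n - h)%nat r) z - J * (L h a z * d_beta (L (n - h)%nat r) z))).
  assert (EW2 : forall h, W2 (S h) = V2 (S h)).
  { intros h; unfold W2, V2.
    rewrite (Ev _ _ _ _ (has_stem_cs_S f p _ Sp Pf) (has_stem_sc_S g b h Sb Cg)).
    rewrite (Ev _ _ _ _ (has_stem_sc_S f a h Sa Cf) (has_stem_cs_S g r _ Sr Pg)).
    rewrite eval_mult_dz_real_l, eval_mult_dz_real_r; reflexivity. }
  (* The missing term [h = 0]: [a] and [b] are twice the spherical values, and this 2 absorbs the
     factor 1/2 in front of the sums. *)
  assert (E0 : (cs_pow (S n) f ⋅ v_s g) (RtoQ alpha + J * RtoQ beta)
             + (v_s f ⋅ cs_pow (S n) g) (RtoQ alpha + J * RtoQ beta)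
             = RtoQ (1 / 2) * V2 0%nat).
  { rewrite (Ev _ _ _ _ (has_stem_cs_S f p _ Sp Pf) Vg).
    rewrite (Ev _ _ _ _ Vf (has_stem_cs_S g r _ Sr Pg)).
    rewrite eval_mult_dz_real_l, eval_mult_dz_real_r; cbv beta.
    unfold V2; rewrite Nat.sub_0_r.
    change (L 0%nat a z) with (a z); change (L 0%nat b z) with (b z).
    fold (L n p) (L n r).
    generalize (a z) (b z) (d_alpha (L n p) z) (d_beta (L n p) z)
      (d_alpha (L n r) z) (d_beta (L n r) z) (1 / 2)%R;
      intros; rewrite !RtoQ_mult; quat_ring. }
  assert (ES : sum_n_m (fun h => RtoQ (Binomial.C n h) * V2 h) 0 n =
    V2 0%nat + sum_n_m (fun h => RtoQ (Binomial.C n h) * W2 h) 1 n).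
  { rewrite sum_Sn_m by lia; rewrite C_n_0; apply (f_equal2 Qplus); [apply Qmult_1_l|].
    apply sum_n_m_ext_loc; intros [|h] Hh; [lia|]; rewrite EW2; reflexivity. }
  rewrite E0, (has_stem_eval _ _ _ _ _ Hcs Hz HJ).
  unfold dz_real; simpl fst; simpl snd.
  change (alpha, beta) with z; rewrite (ET d_alpha HA), (ET d_beta HB) by assumption.
  transitivity (RtoQ (1 / 2) *
    (sum_n_m (fun h => RtoQ (Binomial.C n h) * W1 h) 0 n
     + sum_n_m (fun h => RtoQ (Binomial.C n h) * V2 h) 0 n)).
  2: { rewrite ES; change (RtoQ (1 / 2) *
         (sum_n_m (fun h => RtoQ (Binomial.C n h) * W1 h) 0 n +
          (V2 0%nat + sum_n_m (fun h => RtoQ (Binomial.C n h) * W2 h) 1 n)) =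
       RtoQ (1 / 2) * V2 0%nat + RtoQ (1 / 2) *
         (sum_n_m (fun h => RtoQ (Binomial.C n h) * W1 h) 0 n +
          sum_n_m (fun h => RtoQ (Binomial.C n h) * W2 h) 1 n)).
       generalize (sum_n_m (fun h => RtoQ (Binomial.C n h) * W1 h) 0 n)
         (sum_n_m (fun h => RtoQ (Binomial.C n h) * W2 h) 1 n) (V2 0%nat) (1 / 2)%R; quat_ring. }
  rewrite <- (sum_n_m_plus_quat (fun h => RtoQ (Binomial.C n h) * W1 h)).
  transitivity (RtoQ (1 / 2) * (sum_n_m (fun h => RtoQ (Binomial.C n h) * d_alpha (e h (n - h)%nat) z) 0 n
     + (- J) * (sum_n_m (fun h => RtoQ (Binomial.C n h) * d_beta (e h (n - h)%nat) z) 0 n))).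
  { generalize (sum_n_m (fun h => RtoQ (Binomial.C n h) * d_alpha (e h (n - h)%nat) z) 0 n)
      (sum_n_m (fun h => RtoQ (Binomial.C n h) * d_beta (e h (n - h)%nat) z) 0 n) (1 / 2)%R; quat_ring. }
  f_equal.
  rewrite <- (sum_n_m_mult_l (K := quat_Ring)).
  rewrite <- (sum_n_m_plus_quat).
  (* Term by term: derivatives of [L h a] and [L h b] make up [W1 h], those of [L (n - h) p] and
     [L (n - h) r] make up [V2 h]. *)
  apply sum_n_m_ext; intros h; unfold W1, V2.
  rewrite (Ev _ _ _ _ (has_stem_cs f p _ Sp Pf) (has_stem_sc g b h Sb Cg)).
  rewrite (Ev _ _ _ _ (has_stem_sc f a h Sa Cf) (has_stem_cs g r _ Sr Pg)).
  rewrite (De d_alpha HA), (De d_beta HB) by assumption.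
  fold (L (n - h)%nat p) (L (n - h)%nat r) (L h a) (L h b).
  rewrite !eval_mult_dz_real_l, !eval_mult_dz_real_r.
  fold (L (n - h)%nat p) (L (n - h)%nat r) (L h a) (L h b).
  generalize (d_alpha (L h a) z) (d_beta (L h a) z) (L h a z)
    (d_alpha (L h b) z) (d_beta (L h b) z) (L h b z)
    (d_alpha (L (n - h)%nat p) z) (d_beta (L (n - h)%nat p) z) (L (n - h)%nat p z)
    (d_alpha (L (n - h)%nat r) z) (d_beta (L (n - h)%nat r) z) (L (n - h)%nat r z)
    (Binomial.C n h) (1 / 2)%R.
  unfold mult; simpl Ring.mult; intros; rewrite !RtoQ_mult; quat_ring.
Qed.

End Stems.

Theorem proposition2p4
  (D : C -> Prop) (f g : quat -> quat)
  (D_open : open D) (D_sym : conj_invariant D)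
  (f_reg : slice_regular D f) (g_reg : slice_regular D g)
  (k : nat) (hk : (1 <= k)%nat)
  (x : quat) (hx : circularization D x) (x_nonreal : forall r : R, x <> RtoQ r) :
  cs_pow k (f ⋅ g) x =
    (cs_pow k f ⋅ v_s g) x + (v_s f ⋅ cs_pow k g) x
    + RtoQ (1 / 2) *
      (sum_n_m (fun h : nat =>
         RtoQ (Binomial.C (k - 1) h) *
         ((∂s (cs_pow (k - (h + 1)) f) ⋅ ∂c (sc_pow h g)) x
          + (∂c (sc_pow h f) ⋅ ∂s (cs_pow (k - (h + 1)) g)) x)) 0 (k - 1)
       + sum_n_m (fun h : nat =>
         RtoQ (Binomial.C (k - 1) h) *
         ((cs_pow (k - h) f ⋅ sc_pow h g) x
          + (sc_pow h f ⋅ cs_pow (k - h) g) x)) 1 (k - 1)).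
Proof.
  destruct k as [|n]; [lia|].
  replace (S n - 1)%nat with n by lia.
  destruct f_reg as (F & HF & HFh & HfF), g_reg as (G & HG & HGh & HgG).
  (* The real axis is removed because [∂s] divides by [Im z]. The result is again open and
     symmetric, and stems restrict to it. *)
  set (E := fun z : C => D z /\ Im z <> 0%R).
  assert (E_open : open E).
  { apply open_and; [assumption|].
    apply (open_comp Im (fun y : R => y <> 0%R)); [|apply open_neq].
    intros [a b] _; apply continuous_snd. }
  assert (E_nonreal : forall z, E z -> Im z <> 0%R) by (intros z Hz; apply Hz).
  assert (E_sym : conj_invariant E).
  { intros z; unfold E; rewrite (D_sym z); simpl; split; intros [H1 H2]; (split; [exact H1|]);
      unfold Im in *; lra. }
  assert (E_circ : forall y, circularization E y -> circularization D y).
  { intros y (al & be & J & Hz & HJ & ->); apply circularization_intro; [apply Hz | exact HJ]. }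
  assert (E_x : circularization E x).
  { destruct hx as (al & be & J & Hz & HJ & ->); apply circularization_intro; [|exact HJ].
    (* If [be] were 0, the point would be the real number [al]. *)
    split; [exact Hz|]; simpl; intros ->; apply (x_nonreal al); quat_ring. }
  assert (Rst : forall h H, stem_fun D H -> (forall y, circularization D y -> h y = induced H y) ->
    has_stem E h H).
  { intros h H H1 H2; split.
    - intros z Hz; apply H1, Hz.
    - intros y Hy; apply H2, E_circ, Hy. }
  assert (C1E : forall u, C1_quat D u -> C1_quat E u).
  { intros u (A0 & A1 & A2 & A3); split; [|split; [|split]];
      intros z Hz; [apply A0 | apply A1 | apply A2 | apply A3]; apply Hz. }
  assert (Rh : forall H, holomorphic_stem D H -> holomorphic_stem E H).
  { intros H (A & B & CR); split; [apply C1E, A | split; [apply C1E, B|]].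
    intros z Hz; apply CR, Hz. }
  rewrite (cs_pow_mult E E_open E_nonreal E_sym f g F G n x) by auto.
  f_equal; f_equal; f_equal; apply sum_n_m_ext_loc; intros h Hh.
  - replace (S n - (h + 1))%nat with (n - h)%nat by lia; reflexivity.
  - replace (S n - h)%nat with (S (n - h)) by lia; reflexivity.
Qed.
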